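(* Let $\psi:\partial Q_T\to\mathbb R$ be Lipschitz continuous in $t$ and Hölder continuous with exponent $\gamma$ in $x$, where $\gamma\in(0,1)$ is the barrier exponent of $\Omega$, and let $f$ be uniformly bounded on $Q_T=\Omega\times(0,T)$, with $|f|_\infty=\sup_{Q_T}|f|$. Then there exists a continuous function $W$ which is a viscosity supersolution of $W_t-F(x,\nabla W,D^2W)-h(x,t)\cdot\nabla W|\nabla W|^\alpha\ge|f|_\infty$ in $Q_T$ with $W=\psi$ on $\partial Q_T$, and there exists a continuous function $V$ which is a viscosity subsolution of $V_t-F(x,\nabla V,D^2V)-h(x,t)\cdot\nabla V|\nabla V|^\alpha\le-|f|_\infty$ in $Q_T$ with $V=\psi$ on $\partial Q_T$.
   Context: $S$ denotes the real symmetric $N\times N$ matrices, $T>0$, $\alpha>-1$, and $0<a\le A$ are constants. The parabolic boundary is $\partial Q_T=(\partial\Omega\times(0,T))\cup(\Omega\times\{0\})$. ''$\psi$ is Lipschitz in $t$ and $\gamma$-Hölder in $x$'' means $|\psi(x,t)-\psi(y,s)|\le c_\psi|x-y|^\gamma+L_\psi|t-s|$ for all $(x,t),(y,s)\in\partial Q_T$ and some constants $c_\psi,L_\psi$. $W$ and $V$ are continuous on $Q_T\cup\partial Q_T$. Domain. $\Omega\subset\mathbb R^N$ is a bounded domain with the uniform exterior cone condition: there are $\phi\in(0,\pi)$, $\bar r>0$ such that for every $z\in\partial\Omega$ there is a unit vector $\vec n_z$ with $T_\phi\cap\overline\Omega\cap B_{\bar r}(z)=\{z\}$, where $T_\phi=\{z\}\cup\{x\ne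 z:\frac{(x-z)\cdot\vec n_z}{|x-z|}\le\cos\phi\}$. Assumptions on $F:\Omega\times(\mathbb R^N\setminus\{0\})\times S\to\mathbb R$: (1) $F$ is continuous and $F(x,tp,\mu X)=|t|^\alpha\mu F(x,p,X)$ for all $t\in\mathbb R\setminus\{0\}$, $\mu\ge0$, $x\in\Omega$, $p\ne0$, $X\in S$. (2) For $x\in\Omega$, $p\neq0$, $M,N\in S$, $N\ge0$: $a|p|^\alpha\mathrm{tr}(N)\le F(x,p,M+N)-F(x,p,M)\le A|p|^\alpha\mathrm{tr}(N)$. (3) There is a continuous $\omega$ with $\omega(0)=0$ such that if $X,Y\in S$, $\zeta\ge0$ satisfy $-\zeta\begin{pmatrix}I&0\\0&I\end{pmatrix}\le\begin{pmatrix}X&0\\0&Y\end{pmatrix}\le4\zeta\begin{pmatrix}I&-I\\-I&I\end{pmatrix}$, then for all $x\ne y$ in $\Omega$: $F(x,\zeta(x-y),X)-F(y,\zeta(x-y),-Y)\le\omega(\zeta|x-y|^2)$. Assumptions on $h:Q_T\to\mathbb R^N$: $h$ is continuous and bounded; there are $c_h>0$, $\omega_h\in(0,1]$ with $|h(x,t)-h(x,s)|\le c_h|t-s|^{\omega_h}$; and, for all $x,y\in\Omega$, $t\in(0,T)$: if $\alpha\le0$, $|h(x,t)-h(y,t)|\le c_h|x-y|^{1+\alpha}$; if $\alpha>0$, $(h(x,t)-h(y,t))\cdot(x-y)\le0$. Barrier exponent. $\gamma\in(0,1)$ is a fixed exponent, depending on the cone parameters, for which there are $0<\underline c\le\overline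 c$ and, for every $z\in\partial\Omega$, a function $W_z$ continuous on $\overline\Omega$ with $W_z(z)=0$, $\underline c|x-z|^\gamma\le W_z(x)\le\overline c|x-z|^\gamma$ for $x\in\Omega$, such that every $C^2$ function touching $W_z$ from below at a point of $\Omega$ has nonzero gradient there, and, in the viscosity sense in $\Omega$ for every $t\in(0,T)$, $F(x,\nabla W_z,D^2W_z)+h(x,t)\cdot\nabla W_z|\nabla W_z|^\alpha\le-1$ and $F(x,\nabla(-W_z),D^2(-W_z))-h(x,t)\cdot\nabla W_z|\nabla W_z|^\alpha\ge1$. (Existence of such $\gamma$ is a known result.) Viscosity sub/supersolutions (continuous case). A continuous $u$ is a subsolution of $u_t-F(x,\nabla u,D^2u)-h\cdot\nabla u|\nabla u|^\alpha\le g$ in $Q_T$ if for every $(\bar x,\bar t)\in Q_T$: (i) for every $C^2$ function $\varphi$ touching $u$ from above at $(\bar x,\bar t)$ with $\nabla_x\varphi(\bar x,\bar t)\ne0$, one has $\varphi_t-F(\bar x,\nabla\varphi,D^2\varphi)-h\cdot\nabla\varphi|\nabla\varphi|^\alpha\le g$ at $(\bar x,\bar t)$; (ii) whenever there are $\delta_1>0$ and $\varphi\in C^2((\bar t-\delta_1,\bar t+\delta_1))$ with $\varphi(\bar t)=0$, $u(\bar x,\bar t)\ge u(\bar x,t)-\varphi(t)$ for $|t-\bar t|<\delta_1$, and $x\mapsto\sup_{|t-\bar t|<\delta_1}(u(x,t)-\varphi(t))$ constant in a neighborhood of $\bar x$, then $\varphi'(\bar t)\le g(\bar x,\bar t)$.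 Supersolution: the same with ''touching from below'', all inequalities reversed, and $\inf$ instead of $\sup$. *)

(* Defs.v *)
From mathcomp Require Export all_boot all_order all_algebra.
From mathcomp Require Export all_classical all_reals all_analysis.
Export Order.TTheory GRing.Theory Num.Theory.
Export numFieldNormedType.Exports.

Set Implicit Arguments.
Unset Strict Implicit.
Unset Printing Implicit Defensive.

#[export] Set Implicit Arguments.
#[export] Unset Strict Implicit.
#[export] Unset Printing Implicit Defensive.

Local Open Scope classical_set_scope.
Local Open Scope ring_scope.

Section Euclidean.
Context {R : realType}.

Definition dot {n : nat} (u v : 'rV[R]_n) : R := \sum_i u 0 i * v 0 i.

(* [`|u|] on ['rV_n] is the sup norm; this is the Euclidean one. *)
Definition enorm {n : nat} (u : 'rV[R]_n) : R := Num.sqrt (dot u u).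

Definition symmx {n : nat} (X : 'M[R]_n) : Prop := X^T = X.

Definition mxle {n : nat} (X Y : 'M[R]_n) : Prop :=
  forall v : 'rV[R]_n, dot (v *m X) v <= dot (v *m Y) v.

End Euclidean.

Section C2.
Context {R : realType}.

(* For finite-dimensional V and open U: quantifying over all directions is the
   same as asking that the first and second partial derivatives exist and are
   continuous on U. *)
Definition C2_on {V : normedModType R} (U : set V) (f : V -> R) : Prop :=
  forall x, U x ->
  [/\ {for x, continuous f},
      forall v, derivable f x v /\ {for x, continuous ('D_v f)} &
      forall v w, derivable ('D_v f) x w /\
                  {for x, continuous ('D_w ('D_v f))}].

Definition C2_near {V : normedModType R} (x : V) (f : V -> R) : Prop :=
  exists2 U : set V, open_nbhs x U & C2_on U f.

Definition touches_above {V : normedModType R} (phi u : V -> R) (x : V) : Prop :=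
  phi x = u x /\ \forall y \near x, u y <= phi y.

Definition touches_below {V : normedModType R} (phi u : V -> R) (x : V) : Prop :=
  phi x = u x /\ \forall y \near x, phi y <= u y.

Definition grad {n : nat} (f : 'rV[R]_n -> R) (x : 'rV[R]_n) : 'rV[R]_n :=
  \row_i 'D_(delta_mx 0 i) f x.

Definition hess {n : nat} (f : 'rV[R]_n -> R) (x : 'rV[R]_n) : 'M[R]_n :=
  \matrix_(i, j) 'D_(delta_mx 0 i) ('D_(delta_mx 0 j) f) x.

End C2.

Section Domain.
Context {R : realType} {n : nat}.
Implicit Types (Omega : set 'rV[R]_n) (T : R).

Definition boundary Omega : set 'rV[R]_n := closure Omega `\` interior Omega.

Definition bounded_domain Omega : Prop :=
  [/\ open Omega, connected Omega, Omega !=set0 & bounded_set Omega].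

Definition ext_cone (z nz : 'rV[R]_n) (phi : R) : set 'rV[R]_n :=
  [set z] `|` [set x | x != z /\ dot (x - z) nz / enorm (x - z) <= cos phi].

Definition uniform_exterior_cone Omega : Prop :=
  exists phi r : R, [/\ 0 < phi < pi, 0 < r &
    forall z, boundary Omega z -> exists2 nz : 'rV[R]_n, enorm nz = 1 &
      ext_cone z nz phi `&` closure Omega `&` [set x | enorm (x - z) < r]
      = [set z]].

Definition cylinder Omega T : set ('rV[R]_n * R) :=
  [set q | Omega q.1 /\ 0 < q.2 < T].

Definition pboundary Omega T : set ('rV[R]_n * R) :=
  [set q | (boundary Omega q.1 /\ 0 < q.2 < T) \/ (Omega q.1 /\ q.2 = 0)].

End Domain.

Section Equation.
Context {R : realType} {n : nat}.
Implicit Types (Omega : set 'rV[R]_n) (T alpha : R).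
Implicit Types (F : 'rV[R]_n -> 'rV[R]_n -> 'M[R]_n -> R).
Implicit Types (h : 'rV[R]_n * R -> 'rV[R]_n).

(* F, h and the functions on the cylinder are total; only their values on
   Omega x (R^n \ 0) x S, on the cylinder, etc. are ever constrained or used. *)

Definition F_homogeneous Omega alpha F : Prop :=
  {within [set q : 'rV[R]_n * 'rV[R]_n * 'M[R]_n |
             [/\ Omega q.1.1, q.1.2 != 0 & symmx q.2]],
    continuous (fun q => F q.1.1 q.1.2 q.2)} /\
  forall (t mu : R) x p X, t != 0 -> 0 <= mu -> Omega x -> p != 0 -> symmx X ->
    F x (t *: p) (mu *: X) = `|t| `^ alpha * mu * F x p X.

Definition F_elliptic Omega alpha (a A : R) F : Prop :=
  forall x p X Y, Omega x -> p != 0 -> symmx X -> symmx Y -> mxle 0 Y ->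
    a * enorm p `^ alpha * \tr Y <= F x p (X + Y) - F x p X
                                 <= A * enorm p `^ alpha * \tr Y.

(* For zeta = 0 the gradient argument zeta (x - y) is 0, where F is not defined;
   hence 0 < zeta. *)
Definition F_modulus Omega F : Prop :=
  exists2 omega : R -> R,
    {within [set r | 0 <= r], continuous omega} /\ omega 0 = 0 &
  forall (X Y : 'M[R]_n) (zeta : R), symmx X -> symmx Y -> 0 < zeta ->
    mxle (- (zeta *: block_mx 1%:M 0 0 1%:M)) (block_mx X 0 0 Y) ->
    mxle (block_mx X 0 0 Y)
      ((4 * zeta) *: block_mx 1%:M (- 1%:M) (- 1%:M) 1%:M) ->
    forall x y, Omega x -> Omega y -> x != y ->
      F x (zeta *: (x - y)) X - F y (zeta *: (x - y)) (- Y)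
        <= omega (zeta * enorm (x - y) ^+ 2).

Definition h_assumption Omega T alpha h : Prop :=
  [/\ {within cylinder Omega T, continuous h},
      exists M : R, forall q, cylinder Omega T q -> enorm (h q) <= M &
      exists ch wh : R, [/\ 0 < ch, 0 < wh <= 1,
        forall x t s, Omega x -> 0 < t < T -> 0 < s < T ->
          enorm (h (x, t) - h (x, s)) <= ch * `|t - s| `^ wh,
        alpha <= 0 -> forall x y t, Omega x -> Omega y -> 0 < t < T ->
          enorm (h (x, t) - h (y, t)) <= ch * enorm (x - y) `^ (1 + alpha) &
        0 < alpha -> forall x y t, Omega x -> Omega y -> 0 < t < T ->
          dot (h (x, t) - h (y, t)) (x - y) <= 0]].

Definition spatial_op F h alpha (q : 'rV[R]_n * R) (p : 'rV[R]_n)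
    (X : 'M[R]_n) : R :=
  F q.1 p X + dot (h q) p * enorm p `^ alpha.

(* If phi touches -W_z from above, then grad phi stands for -grad W_z, so that
   - h . grad W_z |grad W_z|^alpha becomes + h . grad phi |grad phi|^alpha. *)
Definition barrier_exponent Omega T alpha F h (gamma : R) : Prop :=
  0 < gamma < 1 /\
  exists c C : R, 0 < c <= C /\
  forall z, boundary Omega z -> exists Wz : 'rV[R]_n -> R,
  [/\ {within closure Omega, continuous Wz},
      Wz z = 0,
      forall x, Omega x ->
        c * enorm (x - z) `^ gamma <= Wz x <= C * enorm (x - z) `^ gamma,
      forall x phi, Omega x -> C2_near x phi -> touches_below phi Wz x ->
        grad phi x != 0 &
      forall t, 0 < t < T ->
        (forall x phi, Omega x -> C2_near x phi -> touches_below phi Wz x ->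
           spatial_op F h alpha (x, t) (grad phi x) (hess phi x) <= - 1) /\
        (forall x phi, Omega x -> C2_near x phi ->
           touches_above phi (fun y => - Wz y) x ->
           1 <= spatial_op F h alpha (x, t) (grad phi x) (hess phi x))].

Definition parabolic_op F h alpha (phi : 'rV[R]_n * R -> R)
    (q : 'rV[R]_n * R) : R :=
  derive1 (fun s => phi (q.1, s)) q.2 -
  spatial_op F h alpha q (grad (fun y => phi (y, q.2)) q.1)
                         (hess (fun y => phi (y, q.2)) q.1).

(* In the degenerate clauses the time interval is required to lie in (0,T), where
   u is defined, and the sup/inf are taken in the extended reals, since the real
   [sup] of an unbounded set is 0. *)
Definition subsolution Omega T alpha F h (g u : 'rV[R]_n * R -> R) : Prop :=
  {within cylinder Omega T, continuous u} /\
  forall x t, Omega x -> 0 < t < T ->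
  (forall phi : 'rV[R]_n * R -> R, C2_near (x, t) phi ->
     touches_above phi u (x, t) -> grad (fun y => phi (y, t)) x != 0 ->
     parabolic_op F h alpha phi (x, t) <= g (x, t)) /\
  (forall (delta : R) (phi : R -> R), 0 < delta ->
     ball t delta `<=` [set s | 0 < s < T] ->
     C2_on (ball t delta) phi -> phi t = 0 ->
     (forall s, ball t delta s -> u (x, s) - phi s <= u (x, t)) ->
     (exists k, \forall y \near x,
        ereal_sup [set (u (y, s) - phi s)%:E | s in ball t delta] = k) ->
     derive1 phi t <= g (x, t)).

Definition supersolution Omega T alpha F h (g u : 'rV[R]_n * R -> R) : Prop :=
  {within cylinder Omega T, continuous u} /\
  forall x t, Omega x -> 0 < t < T ->
  (forall phi : 'rV[R]_n * R -> R, C2_near (x, t) phi ->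
     touches_below phi u (x, t) -> grad (fun y => phi (y, t)) x != 0 ->
     g (x, t) <= parabolic_op F h alpha phi (x, t)) /\
  (forall (delta : R) (phi : R -> R), 0 < delta ->
     ball t delta `<=` [set s | 0 < s < T] ->
     C2_on (ball t delta) phi -> phi t = 0 ->
     (forall s, ball t delta s -> u (x, t) <= u (x, s) - phi s) ->
     (exists k, \forall y \near x,
        ereal_inf [set (u (y, s) - phi s)%:E | s in ball t delta] = k) ->
     g (x, t) <= derive1 phi t).

Definition lip_holder Omega T (gamma : R) (psi : 'rV[R]_n * R -> R) : Prop :=
  exists c L : R, forall x t y s,
    pboundary Omega T (x, t) -> pboundary Omega T (y, s) ->
    `|psi (x, t) - psi (y, s)| <= c * enorm (x - y) `^ gamma + L * `|t - s|.

Definition bounded_on_cylinder Omega T (f : 'rV[R]_n * R -> R) : Prop :=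
  exists M : R, forall q, cylinder Omega T q -> `|f q| <= M.

Definition sup_norm Omega T (f : 'rV[R]_n * R -> R) : R :=
  sup [set `|f q| | q in cylinder Omega T].

End Equation.

(* Main.v *)
Require Import Defs.
From mathcomp Require Import ring lra.

Local Open Scope classical_set_scope.
Local Open Scope ring_scope.

(* The barriers [Wz] carry no common modulus of continuity, so their infimum over
   [z] in the boundary need not be continuous.  Instead take, for every natural [k],
   a finite net of boundary points [z] with the functions
     psi (z, t) + (slope + k) Wz(x),
   and a finite net of points [z] of Omega with the functions
     psi (z, 0) + 1/(k+1) + C_k |x - z|^(2m+4) + M_k t,   M_k >= L + k,
   where [m] is so large that |p|^alpha D^2 stays bounded for the power.  Each of
   them is a supersolution lying above [psi] (up to its modulus of continuity), and
   since the slopes tend to infinity only finitely many matter near a given point of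
   the cylinder.  Hence the infimum [W] is continuous and attained, so that every
   test function touching [W] from below touches one member of the family.  A fine
   enough net gives [W = psi] on the parabolic boundary.  In the degenerate clause
   a function of time alone touches a member from below: impossible for the first
   kind, where test functions have nonzero gradient, and harmless for the second,
   whose time derivative is [M_k].  The subsolution is [- W] for the operator
   [- F x (- p) (- X)] and the datum [- psi]. *)

(** * Euclidean norm, powers and finite nets *)

Section EuclideanFacts.
Context {R : realType} {n : nat}.
Implicit Types (u v w : 'rV[R]_n) (c : R).

Lemma dotC u v : dot u v = dot v u.
Proof. by apply: eq_bigr => i _; rewrite mulrC. Qed.

Lemma dotDl u v w : dot (u + v) w = dot u w + dot v w.
Proof. by rewrite /dot -big_split; apply: eq_bigr => i _; rewrite !mxE mulrDl. Qed.

Lemma dotZl c u v : dot (c *: u) v = c * dot u v.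
Proof. by rewrite /dot mulr_sumr; apply: eq_bigr => i _; rewrite !mxE mulrA. Qed.

Lemma dot0l v : dot 0 v = 0.
Proof. by rewrite -(scale0r v) dotZl mul0r. Qed.

Lemma dotNl u v : dot (- u) v = - dot u v.
Proof. by rewrite -scaleN1r dotZl mulN1r. Qed.

Lemma dotDr u v w : dot w (u + v) = dot w u + dot w v.
Proof. by rewrite dotC dotDl !(dotC w). Qed.

Lemma dotZr c u v : dot u (c *: v) = c * dot u v.
Proof. by rewrite dotC dotZl dotC. Qed.

Lemma dotNr u v : dot u (- v) = - dot u v.
Proof. by rewrite dotC dotNl dotC. Qed.

Lemma dot_ge0 u : 0 <= dot u u.
Proof. by apply: sumr_ge0 => i _; rewrite -expr2 sqr_ge0. Qed.

Lemma dot_eq0 u : (dot u u == 0) = (u == 0).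
Proof.
apply/idP/eqP => [|->]; last first.
  by rewrite /dot big1// => i _; rewrite mxE mul0r.
rewrite psumr_eq0 => [/allP u0|i _]; last by rewrite -expr2 sqr_ge0.
apply/rowP => i; rewrite mxE; apply/eqP.
by have := u0 i (mem_index_enum _); rewrite /= mulf_eq0 orbb.
Qed.

(** Cauchy-Schwarz: expand the nonnegative square of [dot v v *: u - dot u v *: v] and cancel one
    factor [dot v v]. *)
Lemma dot_sqr u v : dot u v ^+ 2 <= dot u u * dot v v.
Proof.
have [/eqP|v0] := eqVneq (dot v v) 0.
  rewrite dot_eq0 => /eqP ->; have -> : (0 : 'rV[R]_n) = 0 *: 0 by rewrite scale0r.
  by rewrite !dotZr !mul0r !mulr0 expr0n.
have vp : 0 < dot v v by rewrite lt_def v0 dot_ge0.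
have := dot_ge0 (dot v v *: u - dot u v *: v).
rewrite !(dotDl, dotDr, dotNl, dotNr, dotZl, dotZr) (dotC v u) => H.
rewrite -subr_ge0 -(pmulr_rge0 _ vp); apply: le_trans H _.
by rewrite le_eqVlt; apply/orP; left; apply/eqP; ring.
Qed.

Lemma enorm_ge0 u : 0 <= enorm u.
Proof. exact: sqrtr_ge0. Qed.

Lemma enorm_sqr u : enorm u ^+ 2 = dot u u.
Proof. by rewrite sqr_sqrtr// dot_ge0. Qed.

Lemma enorm_eq0 u : (enorm u == 0) = (u == 0).
Proof. by rewrite -dot_eq0 -enorm_sqr sqrf_eq0. Qed.

Lemma enorm0 : enorm (0 : 'rV[R]_n) = 0.
Proof. by apply/eqP; rewrite enorm_eq0. Qed.

Lemma enormN u : enorm (- u) = enorm u.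
Proof. by rewrite /enorm dotNl dotNr opprK. Qed.

Lemma enormB u v : enorm (u - v) = enorm (v - u).
Proof. by rewrite -enormN opprB. Qed.

Lemma enormZ c u : enorm (c *: u) = `|c| * enorm u.
Proof. by rewrite /enorm dotZl dotZr mulrA -expr2 sqrtrM ?sqr_ge0// sqrtr_sqr. Qed.

Lemma dot_le_enorm u v : dot u v <= enorm u * enorm v.
Proof.
have p : 0 <= enorm u * enorm v by rewrite mulr_ge0 ?enorm_ge0.
have [d0|d0] := leP (dot u v) 0; first exact: le_trans p.
by rewrite -(ler_pXn2r (n:=2))// ?nnegrE ?(ltW d0)// exprMn !enorm_sqr dot_sqr.
Qed.

Lemma enormD u v : enorm (u + v) <= enorm u + enorm v.
Proof.
have p := enorm_ge0.
rewrite -(ler_pXn2r (n:=2))// ?nnegrE ?addr_ge0//.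
rewrite enorm_sqr !(dotDl, dotDr) sqrrD !enorm_sqr (dotC v u).
by have := dot_le_enorm u v; lra.
Qed.

Lemma enorm_dist w u v : enorm (u - v) <= enorm (u - w) + enorm (w - v).
Proof. by apply: le_trans (enormD _ _); rewrite addrA subrK. Qed.

Lemma mx_norm_le_enorm u : `|u| <= enorm u.
Proof.
have -> : `|u| = mx_norm u by [].
rewrite mx_normrE; apply: bigmax_le => [|[i j] _/=]; first exact: enorm_ge0.
rewrite ord1 -(ler_pXn2r (n:=2))// ?nnegrE ?enorm_ge0// enorm_sqr real_normK ?num_real//.
rewrite /dot (bigD1 j)//= -expr2 lerDl sumr_ge0// => k _.
by rewrite -expr2 sqr_ge0.
Qed.

(** The sum of squares is at most [n |u|^2 <= (n |u|)^2]. The constant is crude, but only the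
    equivalence of the two norms matters. *)
Lemma enorm_le_mx_norm u : enorm u <= n%:R * `|u|.
Proof.
have p : 0 <= n%:R * `|u| by rewrite mulr_ge0.
rewrite -(ler_pXn2r (n:=2))// ?nnegrE ?enorm_ge0// enorm_sqr.
apply: (@le_trans _ _ (n%:R * `|u| ^+ 2)).
  have -> : n%:R * `|u| ^+ 2 = \sum_(i < n) `|u| ^+ 2.
    by rewrite sumr_const card_ord mulr_natl.
  apply: ler_sum => i _; rewrite -expr2 -[X in X <= _]real_normK ?num_real//.
  rewrite ler_pXn2r ?nnegrE//.
  have -> : `|u| = mx_norm u by [].
  by rewrite mx_normrE; apply: (le_bigmax _ _ (0, i)).
rewrite exprMn ler_wpM2r ?sqr_ge0// -natrX ler_nat.
by case: (n) => // m; rewrite leq_pmulr.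
Qed.

Lemma dot_continuous u : continuous (fun v => dot (v - u) (v - u)).
Proof.
apply: continuous_big => [|i _]; first exact: add_continuous.
have C : continuous (fun v : 'rV[R]_n => v 0 i - u 0 i).
  move=> v; apply: (@cvgB _ _ _ (nbhs v)); last exact: cvg_cst.
  exact: (@coord_continuous R 1 n 0 i v).
rewrite (_ : (fun v : 'rV[R]_n => _) =
  fun v => (v 0 i - u 0 i) * (v 0 i - u 0 i)).
  by move=> v; apply: (@cvgM _ _ (nbhs v)); exact: C.
by apply/funext => v; rewrite !mxE.
Qed.

Lemma enorm_continuous u : continuous (fun v => enorm (v - u)).
Proof.
move=> v; apply: (@continuous_comp _ _ _ (fun v => dot (v - u) (v - u)) Num.sqrt).
  exact: dot_continuous.
exact: sqrt_continuous.
Qed.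

Lemma near_enorm_lt u (e : R) : 0 < e -> \forall v \near u, enorm (v - u) < e.
Proof.
move=> e0; have H := @enorm_continuous u u.
by apply: (cvgr_lt _ H); rewrite subrr enorm0.
Qed.

End EuclideanFacts.

Section Powers.
Context {R : realType}.
Implicit Types (x y g e : R).

(** A ratio [z / (x + y)] in the unit interval is at most its own power of exponent [g <= 1].
    Multiply by the power of [x + y] and add the cases [z = x] and [z = y]. *)
Lemma powR_subadd x y g : 0 <= x -> 0 <= y -> 0 < g <= 1 ->
  (x + y) `^ g <= x `^ g + y `^ g.
Proof.
move=> x0 y0 /andP[g0 g1].
have [s0|s0] := eqVneq (x + y) 0.
  by rewrite s0 powR0 ?gt_eqF// addr_ge0 ?powR_ge0.
have sp : 0 < x + y by rewrite lt_def s0 addr_ge0.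
have H z : 0 <= z -> z <= x + y -> z / (x + y) * (x + y) `^ g <= z `^ g.
  move=> z0 zs; have [->|zn] := eqVneq z 0; first by rewrite !mul0r powR_ge0.
  have zp : 0 < z by rewrite lt_def zn.
  rewrite -[in leRHS](divfK s0 z) powRM ?divr_ge0 ?(ltW sp)//.
  rewrite ler_wpM2r ?powR_ge0// ger1_powR// divr_gt0//=.
  by rewrite ler_pdivrMr// mul1r.
apply: le_trans (lerD (H x x0 _) (H y y0 _)); rewrite ?lerDl ?lerDr//.
by rewrite -mulrDl -mulrDl divff// mul1r.
Qed.

Lemma powR_small g e : 0 < g -> 0 < e ->
  exists2 d, 0 < d & forall x, 0 <= x <= d -> x `^ g <= e.
Proof.
move=> g0 e0; exists (e `^ g^-1); first exact: powR_gt0.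
move=> x /andP[x0 xd]; have /ge0_ler_powR : 0 <= g by exact: ltW.
move=> /(_ x (e `^ g^-1)); rewrite !nnegrE x0 powR_ge0 => /(_ isT isT xd).
by rewrite -powRrM mulVf ?gt_eqF// powRr1// ltW.
Qed.

Lemma powR_le_small_add_pow g c e (m : nat) : 0 < g <= 1 -> (0 < m)%N ->
  0 <= c -> 0 < e ->
  exists2 C, 0 < C & forall x, 0 <= x -> c * x `^ g <= e + C * x ^+ m.
Proof.
move=> /andP[g0 g1] m0 c0 e0.
(* [c + 1] in place of [c] keeps the divisor positive when [c = 0]. *)
have c1 : 0 < c + 1 by rewrite ltr_wpDl.
have [d d0 H] := powR_small g0 (divr_gt0 e0 c1).
exists ((c + 1) * d `^ g / d ^+ m).
  by rewrite !mulr_gt0 ?invr_gt0 ?exprn_gt0 ?powR_gt0.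
move=> x x0; have [xd|/ltW xd] := lerP x d.
  apply: ler_wpDr; first by rewrite !mulr_ge0 ?invr_ge0 ?exprn_ge0 ?powR_ge0// ltW.
  apply: (@le_trans _ _ ((c + 1) * x `^ g)); first by rewrite ler_wpM2r ?powR_ge0// lerDl.
  by rewrite mulrC -ler_pdivlMr// H// x0.
apply: ler_wpDl; first exact: ltW.
have dx : 1 <= x / d by rewrite ler_pdivlMr ?mul1r.
have -> : (c + 1) * d `^ g / d ^+ m * x ^+ m = (c + 1) * (d `^ g * (x / d) ^+ m).
  by rewrite expr_div_n; field; rewrite gt_eqF ?exprn_gt0.
apply: ler_pM; rewrite ?powR_ge0// ?lerDl//.
have -> : x `^ g = d `^ g * (x / d) `^ g.
  by rewrite -powRM ?divr_ge0 ?(ltW d0)// mulrC divfK// gt_eqF.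
rewrite ler_wpM2l ?powR_ge0//; apply: le_trans (ler1_powR dx g1) _.
by rewrite -[leLHS]expr1 ler_weXn2l.
Qed.

End Powers.

(** The closure of [S] is compact and is covered by sup-norm balls centred in [S] itself, so the net
    stays inside [S] even when [S] is not closed. The radius [e / (n + 1)] pays for the passage to
    the Euclidean norm. *)
Lemma finite_net {R : realType} {n : nat} (S : set 'rV[R]_n) (e : R) :
  bounded_set S -> 0 < e ->
  exists2 Z : seq 'rV[R]_n, (forall z, z \in Z -> S z) &
    forall x, S x -> exists2 z, z \in Z & enorm (x - z) < e.
Proof.
move=> bS e0.
have n1 : 0 < n%:R + 1 :> R by rewrite ltr_wpDl.
pose d := e / (n%:R + 1).
have d0 : 0 < d by rewrite divr_gt0.
have : compact (closure S).
  apply: bounded_closed_compact; last exact: closed_closure.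
  have [M [Mr HM]] := bS.
  exists M; split => // r Mr' x clx.
  have [r' /andP[Mr1 r1]] : exists r', M < r' < r by exists ((M + r) / 2); lra.
  have [|y [Sy]] := clx _ (nbhsx_ballx x (r - r') _); first by rewrite subr_gt0.
  rewrite -ball_normE /= => xy.
  have -> : x = y + (x - y) by rewrite addrC subrK.
  apply: le_trans (ler_normD _ _) _.
  by have := HM _ Mr1 _ Sy; rewrite /=; lra.
rewrite compact_cover => /(_ _ S (fun z => ball z d)) [].
- by move=> z _; exact: ball_open.
- move=> x clx; have [z [Sz xz]] := clx _ (nbhsx_ballx x d d0).
  by exists z => //; apply: ball_sym.
move=> D DS cov; exists (finmap.enum_fset D) => [z zD|x Sx].
  by have /set_mem := DS z zD.
have [z zD xz] := cov x (subset_closure Sx).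
exists z => //; apply: le_lt_trans (enorm_le_mx_norm _) _.
move: xz; rewrite -ball_normE /= -normrN opprB => xz.
apply: (@le_lt_trans _ _ (n%:R * d)); first by rewrite ler_wpM2l// ltW.
by rewrite /d mulrA ltr_pdivrMr// mulrDr mulr1 mulrC ltrDl.
Qed.

(** * Directional derivatives *)

Section Directional.
Context {R : realType} {V : normedModType R}.
Implicit Types (f g : V -> R) (x y v w : V) (s h c d e : R).

Lemma eq_is_derive (U : normedModType R) (f g : U -> R) (x v : U) d :
  f =1 g -> is_derive x v f d -> is_derive x v g d.
Proof. by move=> /funext ->. Qed.

Let line_quotient f x v s :
  (fun h => h^-1 *: (((fun s => f (x + s *: v)) \o shift s) (h *: 1) - f (x + s *: v))) =
  (fun h => h^-1 *: ((f \o shift (x + s *: v)) (h *: v) - f (x + s *: v))).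
Proof.
apply/funext => h /=; congr (_ *: (f _ - _)).
by rewrite [h *: 1]mulr1 scalerDl addrCA.
Qed.

Lemma is_derive_line f x v s d :
  is_derive (x + s *: v) v f d <-> is_derive s 1 (fun s => f (x + s *: v)) d.
Proof.
by split=> -[]; rewrite /derivable /derive ?line_quotient => fc fd;
  split; rewrite /derivable /derive ?line_quotient.
Qed.

Lemma derivable_line f x v s : derivable f (x + s *: v) v ->
  is_derive s 1 (fun s => f (x + s *: v)) ('D_v f (x + s *: v)).
Proof. by move=> /derivableP /is_derive_line. Qed.

Lemma is_derive_scale_dir f x v c d :
  is_derive x v f d -> is_derive x (c *: v) f (c * d).
Proof.
move=> fd.
have /is_derive_line fd0 : is_derive (x + 0 *: v) v f d by rewrite scale0r addr0.
suff /is_derive_line : is_derive (0 : R) 1 (fun s => f (x + s *: (c *: v))) (c * d).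
  by rewrite scale0r addr0.
have lin : is_derive (0 : R) 1 (fun s => c * s) c.
  rewrite -[X in is_derive _ _ _ X]mulr1.
  exact: (@is_deriveZ R R R id c 0 1 1 (is_derive_id _ _)).
have := @is_derive1_comp _ (fun s => f (x + s *: v)) (fun s => c * s) 0 d c.
rewrite mulr0 => /(_ fd0 lin); rewrite mulrC; apply: eq_is_derive => s /=.
by rewrite scalerA mulrC.
Qed.

(** Allowing either sign of [h] is what lets it be applied to two-sided difference quotients. *)
Lemma MVT_line f x v h :
  (forall s, `|s| <= `|h| -> derivable f (x + s *: v) v) ->
  exists2 s, `|s| <= `|h| & f (x + h *: v) - f x = h * 'D_v f (x + s *: v).
Proof.
move=> df.
have dl s : `|s| <= `|h| -> is_derive s 1 (fun s => f (x + s *: v)) ('D_v f (x + s *: v)).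
  by move=> sh; apply: derivable_line; exact: df.
have [h0|h0] := leP 0 h.
  have sub s : 0 <= s <= h -> `|s| <= `|h|.
    by case/andP => s0 sh; rewrite !ger0_norm.
  have [s||s] := @MVT_segment _ (fun s => f (x + s *: v))
      (fun s => 'D_v f (x + s *: v)) 0 h h0.
  - rewrite in_itv /= => /andP[s0 sh]; apply: dl; apply: sub.
    by rewrite !ltW.
  - apply: derivable_within_continuous => s; rewrite in_itv /= => /sub /dl sd.
    exact: ex_derive.
  - rewrite in_itv /= => /sub sh; rewrite scale0r addr0 subr0 => E.
    by exists s => //; rewrite E mulrC.
have sub s : h <= s <= 0 -> `|s| <= `|h|.
  by case/andP => hs s0; rewrite !ler0_norm ?lerN2// ltW.
have [s||s] := @MVT_segment _ (fun s => f (x + s *: v))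
    (fun s => 'D_v f (x + s *: v)) h 0 (ltW h0).
- rewrite in_itv /= => /andP[s0 sh]; apply: dl; apply: sub.
  by rewrite !ltW.
- apply: derivable_within_continuous => s; rewrite in_itv /= => /sub /dl sd.
  exact: ex_derive.
- rewrite in_itv /= => /sub sh; rewrite scale0r addr0 sub0r => E.
  by exists s => //; rewrite -opprB E mulrN opprK mulrC.
Qed.

Lemma near_norm x (P : V -> Prop) : (\forall y \near x, P y) ->
  exists2 d, 0 < d & forall y, `|y - x| < d -> P y.
Proof.
move=> /nbhs_ballP [d d0 H]; exists d => // y yd; apply: H.
by rewrite -ball_normE /= -normrN opprB.
Qed.

(** The increment along [v + w] is split into a leg along [v] followed by a leg along [w]. The mean
    value theorem on each leg and continuity of both directional derivatives at [x] give the
    limit. *)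
Lemma is_derive_add_dir f x v w :
  (\forall y \near x, derivable f y v) -> (\forall y \near x, derivable f y w) ->
  {for x, continuous ('D_v f)} -> {for x, continuous ('D_w f)} ->
  is_derive x (v + w) f ('D_v f x + 'D_w f x).
Proof.
move=> dv dw cv cw.
suff H : h^-1 *: ((f \o shift x) (h *: (v + w)) - f x) @[h --> 0^'] -->
    'D_v f x + 'D_w f x.
  by split; [apply/cvg_ex; exists ('D_v f x + 'D_w f x)|exact: cvg_lim].
apply/cvgrPdist_le => e e0.
have e2 : 0 < e / 2 by rewrite divr_gt0.
have [d d0 H] : exists2 d, 0 < d & forall y, `|y - x| < d ->
  [/\ derivable f y v, derivable f y w, `|'D_v f x - 'D_v f y| <= e / 2 &
      `|'D_w f x - 'D_w f y| <= e / 2].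
  apply: near_norm.
  move/cvgrPdist_le : cv => /(_ _ e2) cv; move/cvgrPdist_le : cw => /(_ _ e2) cw.
  apply: filterS (filterI (filterI dv dw) (filterI cv cw)).
  move=> y [[d1 d2] [c1 c2]]; exact: And4 d1 d2 c1 c2.
(* With [|h| < d / k] both legs of the path stay within distance [d] of [x]. *)
pose k := `|v| + `|w| + 1.
have k0 : 0 < k by rewrite ltr_wpDl// addr_ge0.
have small s s' h : `|h| < d / k -> `|s| <= `|h| -> `|s'| <= `|h| ->
    `|x + s *: v + s' *: w - x| < d.
  move=> hd sh sh'; rewrite -[x + _ + _]addrA [x + _]addrC addrK.
  apply: le_lt_trans (ler_normD _ _) _; rewrite !normrZ.
  rewrite ltr_pdivlMr// in hd; apply: le_lt_trans hd.
  rewrite /k !mulrDr mulr1 -[leLHS]addr0; apply: lerD => //.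
  by apply: lerD; rewrite ler_wpM2r.
have small1 s h : `|h| < d / k -> `|s| <= `|h| -> `|x + s *: v - x| < d.
  move=> hd sh; have := small s 0 h hd sh.
  by rewrite normr0 normr_ge0 scale0r addr0; apply.
rewrite near_withinE; apply: filterS (nbhs0_lt (divr_gt0 d0 k0)) => h hd h0.
have [s1 s1h E1] : exists2 s, `|s| <= `|h| &
    f (x + h *: v + h *: w) - f (x + h *: v) = h * 'D_w f (x + h *: v + s *: w).
  apply: MVT_line => s sh; have [_ d2 _ _] := H _ (small h s h hd (lexx _) sh).
  exact: d2.
have [s2 s2h E2] : exists2 s, `|s| <= `|h| &
    f (x + h *: v) - f x = h * 'D_v f (x + s *: v).
  apply: MVT_line => s sh; have [d1 _ _ _] := H _ (small1 s h hd sh).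
  exact: d1.
have -> : h^-1 *: ((f \o shift x) (h *: (v + w)) - f x) =
    'D_w f (x + h *: v + s1 *: w) + 'D_v f (x + s2 *: v).
  rewrite /= [h *: (v + w)]scalerDr [_ + x]addrC addrA.
  have -> : f (x + h *: v + h *: w) - f x =
     h * ('D_w f (x + h *: v + s1 *: w) + 'D_v f (x + s2 *: v)).
    by rewrite mulrDr -E1 -E2 addrA subrK.
  by rewrite [_ *: _]mulrA mulVf// mul1r.
have [_ _ _ B1] := H _ (small h s1 h hd (lexx _) s1h).
have [_ _ B2 _] := H _ (small1 s2 h hd s2h).
move: ('D_w f (x + h *: v + s1 *: w)) ('D_v f (x + s2 *: v)) B1 B2 => a b B1 B2.
rewrite [a + b]addrC opprD addrACA.
apply: le_trans (ler_normD _ _) _.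
by rewrite [leRHS](splitr e) lerD.
Qed.

(** Schwarz's theorem: the second difference over a small parallelogram, evaluated by two mean value
    steps in each order, equates the mixed derivatives at two nearby points. Continuity brings both
    back to [x]. *)
Lemma derive_comm f x v w :
  (\forall y \near x, [/\ derivable f y v, derivable f y w,
     derivable ('D_v f) y w & derivable ('D_w f) y v]) ->
  {for x, continuous ('D_w ('D_v f))} -> {for x, continuous ('D_v ('D_w f))} ->
  'D_w ('D_v f) x = 'D_v ('D_w f) x.
Proof.
move=> df cvw cwv.
suff H e : 0 < e -> `|'D_w ('D_v f) x - 'D_v ('D_w f) x| <= e.
  apply/eqP; rewrite -subr_eq0 -normr_le0 leNgt; apply/negP => p.
  by have := H _ (divr_gt0 p (ltr0n _ 2)); lra.
move=> e0; have e2 : 0 < e / 2 by rewrite divr_gt0.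
have [d d0 H] : exists2 d, 0 < d & forall y, `|y - x| < d ->
  [/\ [/\ derivable f y v, derivable f y w,
     derivable ('D_v f) y w & derivable ('D_w f) y v],
     `|'D_w ('D_v f) x - 'D_w ('D_v f) y| <= e / 2 &
     `|'D_v ('D_w f) x - 'D_v ('D_w f) y| <= e / 2].
  apply: near_norm.
  move/cvgrPdist_le : cvw => /(_ _ e2) cvw; move/cvgrPdist_le : cwv => /(_ _ e2) cwv.
  apply: filterS (filterI df (filterI cvw cwv)).
  move=> y [d1 [c1 c2]]; exact: And3 d1 c1 c2.
pose k := `|v| + `|w| + 1.
have k0 : 0 < k by rewrite ltr_wpDl// addr_ge0.
pose h := d / k / 2.
have h0 : 0 < h by rewrite !divr_gt0.
have small s s' : `|s| <= `|h| -> `|s'| <= `|h| -> `|x + s *: v + s' *: w - x| < d.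
  move=> sh sh'; rewrite -[x + _ + _]addrA [x + _]addrC addrK.
  apply: le_lt_trans (ler_normD _ _) _; rewrite !normrZ.
  have hd : `|h| < d / k by rewrite gtr0_norm// /h ltr_pdivrMr// ltr_pMr ?divr_gt0// ltr1n.
  rewrite ltr_pdivlMr// in hd; apply: le_lt_trans hd.
  rewrite /k !mulrDr mulr1 -[leLHS]addr0; apply: lerD => //.
  by apply: lerD; rewrite ler_wpM2r.
have S s s' : x + s *: v + s' *: w = x + s' *: w + s *: v by rewrite addrAC.
have small1 s : `|s| <= `|h| -> `|x + s *: v - x| < d.
  by move=> sh; have := small s 0 sh; rewrite normr0 normr_ge0 scale0r addr0; apply.
have small2 s : `|s| <= `|h| -> `|x + s *: w - x| < d.
  by move=> sh; have := small 0 s _ sh; rewrite normr0 normr_ge0 scale0r addr0; apply.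
have [s1 s1h E1] : exists2 s, `|s| <= `|h| &
   (f (x + h *: v + h *: w) - f (x + h *: v)) - (f (x + h *: w) - f x) =
   h * ('D_v f (x + s *: v + h *: w) - 'D_v f (x + s *: v)).
  have dg s : `|s| <= `|h| -> is_derive (x + s *: v) v
     (fun y => f (y + h *: w) - f y) ('D_v f (x + s *: v + h *: w) - 'D_v f (x + s *: v)).
    move=> sh.
    have [[d1 _ _ _] _ _] := H _ (small s h sh (lexx _)).
    have [[d2 _ _ _] _ _] := H _ (small1 s sh).
    have i2 := derivableP d2.
    suff i1 : is_derive (x + s *: v) v (fun y => f (y + h *: w)) ('D_v f (x + s *: v + h *: w)).
      exact: is_deriveB.
    move/derivableP : d1; rewrite S => /is_derive_line i1; apply/is_derive_line.
    by apply: eq_is_derive i1 => s'; rewrite addrAC.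
  have [|s sh E] := @MVT_line (fun y => f (y + h *: w) - f y) x v h.
    by move=> s /dg i; exact: ex_derive.
  exists s => //; rewrite E; congr (_ * _); have i := dg _ sh; exact: derive_val.
have [s2 s2h E2] := @MVT_line ('D_v f) (x + s1 *: v) w h
  (fun s sh => let: And3 (And4 _ _ d3 _) _ _ := H _ (small _ _ s1h sh) in d3).
have [_ B1 _] := H _ (small _ _ s1h s2h).
move: ('D_w ('D_v f) (x + s1 *: v + s2 *: w)) B1 E2 => p B1 E2.
have [t1 t1h F1] : exists2 s, `|s| <= `|h| &
   (f (x + h *: w + h *: v) - f (x + h *: w)) - (f (x + h *: v) - f x) =
   h * ('D_w f (x + s *: w + h *: v) - 'D_w f (x + s *: w)).
  have dg s : `|s| <= `|h| -> is_derive (x + s *: w) w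
     (fun y => f (y + h *: v) - f y) ('D_w f (x + s *: w + h *: v) - 'D_w f (x + s *: w)).
    move=> sh.
    have [[_ d1 _ _] _ _] := H _ (small h s (lexx _) sh).
    have [[_ d2 _ _] _ _] := H _ (small2 s sh).
    have i2 := derivableP d2.
    suff i1 : is_derive (x + s *: w) w (fun y => f (y + h *: v)) ('D_w f (x + s *: w + h *: v)).
      exact: is_deriveB.
    move/derivableP : d1; rewrite -S => /is_derive_line i1; apply/is_derive_line.
    by apply: eq_is_derive i1 => s'; rewrite addrAC.
  have [|s sh E] := @MVT_line (fun y => f (y + h *: v) - f y) x w h.
    by move=> s /dg i; exact: ex_derive.
  exists s => //; rewrite E; congr (_ * _); have i := dg _ sh; exact: derive_val.
have dw s : `|s| <= `|h| -> derivable ('D_w f) (x + t1 *: w + s *: v) v.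
  by move=> sh; rewrite -S; have [[_ _ _ d4] _ _] := H _ (small _ _ sh t1h); exact: d4.
have [t2 t2h F2] := @MVT_line ('D_w f) (x + t1 *: w) v h dw.
have [_ _ B2] := H _ (small _ _ t2h t1h).
rewrite S in B2.
move: ('D_v ('D_w f) (x + t1 *: w + t2 *: v)) B2 F2 => q B2 F2.
move: ('D_w ('D_v f) x) ('D_v ('D_w f) x) B1 B2 => X Y B1 B2.
rewrite E2 in E1; rewrite F2 -S in F1.
(* Both [h * (h * p)] and [h * (h * q)] equal the same second difference of [f]. *)
have pq : p = q.
  apply: (mulfI (lt0r_neq0 h0)); apply: (mulfI (lt0r_neq0 h0)).
  by rewrite -E1 -F1; ring.
rewrite pq in B1; rewrite [leRHS](splitr e).
rewrite -(subrKA q X) (le_trans (ler_normD _ _))// lerD// [leLHS]distrC//.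
Qed.

End Directional.

(** * Contact of order two on the line *)

Section OneDim.
Context {R : realType}.
Implicit Types (u du g : R -> R) (t m d : R).

(** Times before [t] suffice: dividing by the negative increment reverses the inequality, so the
    quotients from the left are at least [m]. *)
Lemma derive1_ge_of_left g t m : derivable g t 1 ->
  (\forall s \near t, s < t -> g s - g t <= m * (s - t)) -> m <= derive1 g t.
Proof.
move=> dg gm; rewrite leNgt; apply/negP => lt_m.
have : h^-1 *: ((g \o shift t) (h *: 1) - g t) @[h --> 0^'] --> derive1 g t.
  by rewrite derive1E; exact: dg.
move=> /cvgr_lt /(_ _ lt_m); rewrite near_withinE => H1.
have [d1 d10 {}H1] := near_norm H1.
have [d2 d20 {}H2] := near_norm gm.
pose h := Num.min d1 d2 / 2.
have h0 : 0 < h by rewrite divr_gt0// lt_min d10.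
have [hd1 hd2] : h < d1 /\ h < d2.
  by split; rewrite /h ltr_pdivrMr// mulr_natr mulr2n ltr_pwDl// ge_min lexx ?orbT.
have := H1 (- h); rewrite subr0 normrN gtr0_norm// oppr_eq0 gt_eqF// => /(_ hd1 isT).
have := H2 (t - h); rewrite [t - h]addrC addrK normrN gtr0_norm// => /(_ hd2).
rewrite gtrDr oppr_lt0 => /(_ h0) /=.
rewrite [- h *: 1]mulr1 invrN scaleNr.
set D := g _ - _; rewrite (_ : - (h^-1 *: D) = - D / h) ?ltr_pdivrMr//; first by lra.
by rewrite mulNr mulrC.
Qed.

(** Fermat's rule gives the first part. If [d < 0], then [du] is negative just to the right of [0],
    and the mean value theorem makes [u] negative there. *)
Lemma local_min_derive2 u du d : (\forall s \near (0 : R), is_derive (s : R) 1 u (du s)) ->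
  is_derive (0 : R) 1 du d -> u 0 = 0 -> (\forall s \near (0 : R), 0 <= u s) ->
  du 0 = 0 /\ 0 <= d.
Proof.
move=> hu hdu u0 up.
have [e e0 H] := near_norm (filterI hu up).
have inE s : s \in `](- e), e[ -> `|s - 0| < e.
  by rewrite in_itv/= subr0 ltr_norml.
have z : (0 : R) \in `](- e), e[ by rewrite in_itv /= oppr_lt0 e0.
have du0 : du 0 = 0.
  have [d0 _] := H 0 (inE 0 z).
  have dd s : s \in `](- e), e[ -> derivable u s 1.
    by move=> /inE /H [ds _]; exact: ex_derive.
  have dm s : s \in `](- e), e[ -> u 0 <= u s.
    by move=> /inE /H [_]; rewrite u0.
  have ee : - e <= e by lra.
  have i0 := derive1_at_min ee dd z dm.
  transitivity ('D_1 u 0); [apply: esym|]; exact: derive_val.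
split=> //; rewrite leNgt; apply/negP => d0.
have : h^-1 *: ((du \o shift 0) (h *: 1) - du 0) @[h --> 0^'] --> d.
  by have [cd dd] := hdu; rewrite -dd; exact: cd.
move=> /cvgr_lt /(_ _ d0); rewrite near_withinE => H1.
have [e1 e10 {}H1] := near_norm H1.
pose h := Num.min e e1 / 2.
have h0 : 0 < h by rewrite divr_gt0// lt_min e0.
have [hd1 hd2] : h < e /\ h < e1.
  by split; rewrite /h ltr_pdivrMr// mulr_natr mulr2n ltr_pwDl// ge_min lexx ?orbT.
have inh s : 0 <= s <= h -> `|s - 0| < e.
  by case/andP => s0 sh; rewrite subr0 ger0_norm//; exact: le_lt_trans hd1.
have [s||s] := @MVT _ u du 0 h h0.
- rewrite in_itv /= => /andP[s0 sh].
  by have [|i _] := H s; [apply: inh; rewrite !ltW|exact: i].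
- apply: derivable_within_continuous => s; rewrite in_itv /= => /inh /H [i _].
  exact: ex_derive.
rewrite in_itv /= => /andP[s0 sh]; rewrite u0 !subr0 => E.
have hh : 0 <= h <= h by rewrite lexx ltW.
have [_ uh] := H h (inh h hh).
have := H1 s; rewrite subr0 gtr0_norm// gt_eqF// => /(_ (lt_trans sh hd2) isT) /=.
rewrite [s *: 1]mulr1 addr0 du0 subr0 [_ *: _]mulrC ltr_pdivrMr// mul0r => dus.
by move: uh; rewrite E pmulr_lge0// leNgt dus.
Qed.

End OneDim.

Section SecondOrderContact.
Context {R : realType} {V : normedModType R}.

(** On the line through [x] in direction [v] the difference [B - phi] has a local minimum at
    parameter [0]. Explicit derivatives of [B] along lines are enough, so [B] itself never has to be
    shown C2. *)
Lemma contact_line (phi B : V -> R) (x v : V) (db : R -> R) (d2b : R) :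
  touches_below phi B x ->
  (\forall y \near x, derivable phi y v) -> derivable ('D_v phi) x v ->
  (forall s : R, is_derive s 1 (fun s => B (x + s *: v)) (db s)) ->
  is_derive (0 : R) 1 db d2b ->
  'D_v phi x = db 0 /\ 'D_v ('D_v phi) x <= d2b.
Proof.
move=> [E le] d1 d2 dB d2B.
have cl : (fun s : R => x + s *: v) @ (0 : R) --> x.
  rewrite -[X in _ --> X]addr0 -[in X in _ + X](scale0r v).
  apply: cvgD; first exact: cvg_cst.
  by apply: cvgZr_tmp; exact: cvg_id.
have near_line (P : V -> Prop) : (\forall y \near x, P y) ->
    \forall s \near (0 : R), P (x + s *: v).
  by move=> nP; exact: cl nP.
have [] := @local_min_derive2 R (fun s => B (x + s *: v) - phi (x + s *: v))
  (fun s => db s - 'D_v phi (x + s *: v)) (d2b - 'D_v ('D_v phi) x).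
- apply: filterS (near_line _ d1) => s ds.
  exact: (is_deriveB (dB s) (derivable_line ds)).
- apply: (is_deriveB d2B).
  have d2' : derivable ('D_v phi) (x + 0 *: v) v by rewrite scale0r addr0.
  by have := derivable_line d2'; rewrite scale0r addr0.
- by rewrite scale0r addr0 E subrr.
- by apply: filterS (near_line _ le) => s; rewrite subr_ge0.
rewrite scale0r addr0 subr_ge0 => /eqP; rewrite subr_eq0 => /eqP -> H.
by split.
Qed.

End SecondOrderContact.

(** * C2 functions, their slices and Hessians *)

Section C2Facts.
Context {R : realType} {V : normedModType R}.
Implicit Types (f g : V -> R) (x y v w : V).

(** The condition of [C2_on] at a single point, so that C2 regularity near [x] becomes a statement
    about the neighbourhood filter. *)
Definition C2_at f x : Prop :=
  [/\ {for x, continuous f},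
      forall v, derivable f x v /\ {for x, continuous ('D_v f)} &
      forall v w, derivable ('D_v f) x w /\ {for x, continuous ('D_w ('D_v f))}].

Lemma C2_nearP x f : C2_near x f <-> \forall y \near x, C2_at f y.
Proof.
split=> [[U [oU Ux] H]|].
  by apply: filterS (open_nbhs_nbhs (conj oU Ux)) => y Uy; exact: H.
move=> H; exists (interior (C2_at f)).
  by split; [exact: open_interior|exact: H].
by move=> y /interior_subset.
Qed.

Lemma continuous_near_eq f g x : (\forall y \near x, f y = g y) ->
  {for x, continuous f} -> {for x, continuous g}.
Proof.
move=> fg cf; have gf : g @ x --> f x.
  apply: cvg_trans cf; apply: near_eq_cvg.
  by apply: filterS fg => y ->.
by rewrite (nbhs_singleton fg) in gf; exact: gf.
Qed.

Lemma is_derive_affine f x v (c d df : R) : is_derive x v f df ->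
  is_derive x v (fun y => c * f y + d) (c * df).
Proof.
move=> i; have j := is_deriveD (is_deriveZ c i) (is_derive_cst d x v).
by rewrite -[c * df]addr0; exact: j.
Qed.

Lemma derive_affine f x v (c d : R) : derivable f x v ->
  'D_v (fun y => c * f y + d) x = c * 'D_v f x.
Proof. by move=> /derivableP /(is_derive_affine c d) i; exact: derive_val. Qed.

Lemma C2_at_affine f x (c d : R) : (\forall y \near x, C2_at f y) ->
  C2_at (fun y => c * f y + d) x.
Proof.
move=> H; have [cf df d2f] := nbhs_singleton H.
have caff g (b : R) : {for x, continuous g} -> {for x, continuous (fun y => c * g y + b)}.
  move=> cg; apply: (@cvgD _ _ _ (nbhs x)); last exact: cvg_cst.
  by apply: (@cvgM _ _ (nbhs x)); [exact: cvg_cst|exact: cg].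
have E v : \forall y \near x, c * 'D_v f y + 0 = 'D_v (fun y => c * f y + d) y.
  apply: filterS H => y [_ dfy _]; rewrite addr0; apply: esym.
  exact: derive_affine (proj1 (dfy v)).
split; first exact: caff.
  move=> v; split; last exact: continuous_near_eq (E v) (caff _ _ (proj2 (df v))).
  have i := is_derive_affine c d (derivableP (proj1 (df v))).
  exact: (@ex_derive _ _ _ _ _ _ _ i).
move=> v w; split.
  apply: near_eq_derivable (E v) _.
  have i := is_derive_affine c 0 (derivableP (proj1 (d2f v w))).
  exact: (@ex_derive _ _ _ _ _ _ _ i).
apply: continuous_near_eq (caff _ 0 (proj2 (d2f v w))).
have EE : \forall y \near x, \forall z \near y,
    c * 'D_v f z + 0 = 'D_v (fun y => c * f y + d) z.
  by apply: near_join; exact: E.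
apply: filterS (filterI H EE) => y [[_ _ d2y] Ey].
rewrite -(near_eq_derive w Ey) derive_affine; first by rewrite addr0.
exact: (proj1 (d2y v w)).
Qed.

Lemma C2_near_affine f x (c d : R) : C2_near x f ->
  C2_near x (fun y => c * f y + d).
Proof.
move=> /C2_nearP H; apply/C2_nearP.
apply: filterS (near_join H) => y; exact: C2_at_affine.
Qed.

Lemma derive2_affine f x v w (c d : R) : C2_near x f ->
  'D_w ('D_v (fun y => c * f y + d)) x = c * 'D_w ('D_v f) x.
Proof.
move=> /C2_nearP H.
have E : \forall y \near x, c * 'D_v f y + 0 = 'D_v (fun y => c * f y + d) y.
  apply: filterS H => y [_ dfy _]; rewrite addr0; apply: esym.
  exact: derive_affine (proj1 (dfy v)).
have [_ _ d2f] := nbhs_singleton H.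
by rewrite -(near_eq_derive w E) derive_affine//; exact: (proj1 (d2f v w)).
Qed.

Lemma C2_near_cst x (k : R) : C2_near x (fun=> k).
Proof.
have D v : 'D_v (fun=> k : R) = (fun=> 0) :> (V -> R).
  by apply/funext => y; exact: derive_cst.
apply/C2_nearP/nearW => y; split; first exact: cvg_cst.
  by move=> v; rewrite D; split; [exact: derivable_cst|exact: cvg_cst].
move=> v w; rewrite D; split; first exact: derivable_cst.
by rewrite (_ : 'D_w _ = fun=> 0); [exact: cvg_cst|apply/funext => z; exact: derive_cst].
Qed.

Lemma touches_below_affine (f g : V -> R) x (c d : R) : 0 <= c ->
  touches_below f g x ->
  touches_below (fun y => c * f y + d) (fun y => c * g y + d) x.
Proof.
move=> c0 [E H]; split; first by rewrite E.
by apply: filterS H => y fg; rewrite lerD2r ler_wpM2l.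
Qed.

End C2Facts.

Section GradHess.
Context {R : realType} {n : nat}.
Implicit Types (f : 'rV[R]_n -> R) (x v : 'rV[R]_n).

Lemma grad_affine f x (c d : R) : C2_near x f ->
  grad (fun y => c * f y + d) x = c *: grad f x.
Proof.
move=> /C2_nearP /nbhs_singleton [_ df _]; apply/rowP => i; rewrite !mxE.
exact: derive_affine (proj1 (df _)).
Qed.

Lemma hess_affine f x (c d : R) : C2_near x f ->
  hess (fun y => c * f y + d) x = c *: hess f x.
Proof.
by move=> C; apply/matrixP => i j; rewrite !mxE; exact: derive2_affine.
Qed.

Lemma grad_cst x (k : R) : grad (fun=> k) x = 0.
Proof. by apply/rowP => i; rewrite !mxE; exact: derive_cst. Qed.

(** The assumptions on [F] concern symmetric matrices, so every Hessian of a test function has to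
    pass through this consequence of [derive_comm]. *)
Lemma symmx_hess f x : C2_near x f -> symmx (hess f x).
Proof.
move=> /C2_nearP H; apply/matrixP => i j; rewrite !mxE.
have [_ _ d2] := nbhs_singleton H.
apply: derive_comm; [|exact: (proj2 (d2 _ _))|exact: (proj2 (d2 _ _))].
apply: filterS H => y [_ d1 {}d2].
exact: And4 (proj1 (d1 _)) (proj1 (d1 _)) (proj1 (d2 _ _)) (proj1 (d2 _ _)).
Qed.

(** Expand [v] in the standard basis and add up directions one at a time with
    [is_derive_add_dir]. *)
Lemma derive_coord f x v :
  (\forall y \near x, forall u, derivable f y u) ->
  (forall u, {for x, continuous ('D_u f)}) ->
  'D_v f x = \sum_i v 0 i * 'D_(delta_mx 0 i) f x.
Proof.
move=> df cf.
have dfu u : \forall y \near x, derivable f y u.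
  by apply: filterS df => y; exact.
rewrite [in LHS](row_sum_delta v).
apply: (big_ind2 (fun u d => 'D_u f x = d)).
- exact: derive0.
- move=> u d u' d' <- <-.
  have i := is_derive_add_dir (dfu u) (dfu u') (cf u) (cf u').
  exact: derive_val.
- move=> i _.
  have j := is_derive_scale_dir (v 0 i) (derivableP (nbhs_singleton df (delta_mx 0 i))).
  exact: derive_val.
Qed.

(** Links the matrix order to [contact_line]: the coordinate expansion is used once near [x] for the
    first derivative and once at [x] for the second. *)
Lemma hess_quadratic f x v : C2_near x f ->
  dot (v *m hess f x) v = 'D_v ('D_v f) x.
Proof.
move=> /C2_nearP H; have [_ d1 d2] := nbhs_singleton H.
have E : \forall y \near x,
    (\sum_(j < n) (fun z => v 0 j * 'D_(delta_mx 0 j) f z)) y = 'D_v f y.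
  apply: filterS (near_join H) => y Hy; rewrite fct_sumE; apply: esym.
  apply: derive_coord => [|u]; last exact: (proj2 (let: And3 _ d _ := nbhs_singleton Hy in d u)).
  by apply: filterS Hy => z [_ d _] u; exact: (proj1 (d u)).
rewrite -(near_eq_derive v E).
have i j : is_derive x v (fun z => v 0 j * 'D_(delta_mx 0 j) f z)
    (v 0 j * 'D_v ('D_(delta_mx 0 j) f) x).
  exact: (is_deriveZ (v 0 j) (derivableP (proj1 (d2 _ v)))).
rewrite derive_sum => [|j]; last exact: (@ex_derive _ _ _ _ _ _ _ (i j)).
apply: eq_bigr => j _.
rewrite (@derive_val _ _ _ _ _ _ _ (i j)) mulrC mxE; congr (_ * _).
rewrite (@derive_coord ('D_(delta_mx 0 j) f)); last by move=> u; exact: (proj2 (d2 _ u)).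
  by apply: eq_bigr => k _; rewrite mxE.
by apply: filterS H => y [_ _ {}d2] u; exact: (proj1 (d2 _ u)).
Qed.

End GradHess.

Section Slices.
Context {R : realType} {V : normedModType R}.
Implicit Types (phi : V * R -> R) (x v : V) (t : R).

Let slice_quotient phi t v x :
  (fun h => h^-1 *: (((fun y => phi (y, t)) \o shift x) (h *: v) - phi (x, t))) =
  (fun h => h^-1 *: ((phi \o shift (x, t)) (h *: (v, 0)) - phi (x, t))).
Proof.
apply/funext => h /=; congr (_ *: (phi _ - _)).
by rewrite /shift /=; congr (_, _); rewrite /= scaler0 add0r.
Qed.

Lemma derive_slice phi t v :
  'D_v (fun y => phi (y, t)) = (fun y => 'D_(v, 0) phi (y, t)).
Proof. by apply/funext => y; rewrite /derive slice_quotient. Qed.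

Lemma derivable_slice phi t v x :
  derivable phi (x, t) (v, 0) -> derivable (fun y => phi (y, t)) x v.
Proof. by rewrite /derivable slice_quotient. Qed.

Lemma derivable_time_slice phi t x :
  derivable phi (x, t) (0, 1) -> derivable (fun s => phi (x, s)) t 1.
Proof.
rewrite /derivable.
rewrite (_ : (fun h => h^-1 *: (_ - phi (x, t))) =
  (fun h => h^-1 *: (((fun s => phi (x, s)) \o shift t) (h *: 1) - phi (x, t)))) //.
apply/funext => h /=; congr (_ *: (phi _ - _)).
by rewrite /shift /=; congr (_, _); rewrite /= scaler0 add0r.
Qed.

Lemma slice_cvg x t : (fun y : V => (y, t)) @ x --> (x, t).
Proof. exact: (@cvg_pair _ _ _ (nbhs x) (nbhs x) (nbhs t) _ _ _ id (fun=> t) cvg_id (cvg_cst t)). Qed.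

Lemma time_slice_cvg x t : (fun s : R => (x, s)) @ t --> (x, t).
Proof. exact: (@cvg_pair _ _ _ (nbhs t) (nbhs x) (nbhs t) _ _ _ (fun=> x) id (cvg_cst x) cvg_id). Qed.

Lemma near_slice (P : V * R -> Prop) x t : (\forall q \near (x, t), P q) ->
  \forall y \near x, P (y, t).
Proof. by move=> H; exact: slice_cvg H. Qed.

Lemma near_time_slice (P : V * R -> Prop) x t : (\forall q \near (x, t), P q) ->
  \forall s \near t, P (x, s).
Proof. by move=> H; exact: time_slice_cvg H. Qed.

Lemma C2_near_slice phi x t : C2_near (x, t) phi -> C2_near x (fun y => phi (y, t)).
Proof.
move=> /C2_nearP H; apply/C2_nearP.
apply: filterS (near_slice H) => y.
have cs (g : V * R -> R) : {for (y, t), continuous g} -> {for y, continuous (fun y => g (y, t))}.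
  move=> cg; exact: (@continuous_comp V (V * R)%type R (fun y : V => (y, t)) g y (@slice_cvg y t) cg).
move=> [c d1 d2]; split; first exact: cs.
  move=> v; split; first exact: derivable_slice (proj1 (d1 _)).
  by rewrite derive_slice; exact: cs (proj2 (d1 _)).
move=> v w; rewrite derive_slice; split; first exact: derivable_slice (proj1 (d2 _ _)).
rewrite (@derive_slice ('D_(v, 0) phi) t w); exact: cs (proj2 (d2 _ _)).
Qed.

Lemma touches_below_slice phi (u : V * R -> R) x t : touches_below phi u (x, t) ->
  touches_below (fun y => phi (y, t)) (fun y => u (y, t)) x.
Proof. by move=> [E H]; split=> //; exact: (near_slice H). Qed.

Lemma touches_below_time_slice phi (u : V * R -> R) x t :
  touches_below phi u (x, t) ->
  touches_below (fun s => phi (x, s)) (fun s => u (x, s)) t.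
Proof. by move=> [E H]; split=> //; exact: (near_time_slice H). Qed.

End Slices.

(** * Barriers touched from below *)

Section QuadraticPower.
Context {R : realType}.

(** With [r = |x - z|^2], [b = dot (x - z) v] and [k = |v|^2], the quadratic is the squared distance
    from [x + s v] to [z]. *)
Lemma is_derive_quadratic (r b k s : R) :
  is_derive s 1 (fun s => r + 2 * b * s + k * s ^+ 2) (2 * b + 2 * k * s).
Proof.
have i1 := is_deriveZ (2 * b) (is_derive_id s 1).
have i2 := is_deriveZ k (is_deriveX 2 (is_derive_id s 1)).
have i3 := is_deriveD (is_deriveD (is_derive_cst r s 1) i1) i2.
apply: (@is_derive_eq _ _ _ _ _ _ _ _ i3).
by rewrite /GRing.scale /=; ring.
Qed.

Lemma is_derive_quadratic_pow (m : nat) (c r b k s : R) :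
  is_derive s 1 (fun s => c * (r + 2 * b * s + k * s ^+ 2) ^+ m)
    (c * (m%:R * (r + 2 * b * s + k * s ^+ 2) ^+ m.-1 * (2 * b + 2 * k * s))).
Proof.
have i := is_deriveZ c (is_deriveX m (is_derive_quadratic r b k s)).
rewrite exprfctE in i; exact: i.
Qed.

Lemma is_derive2_quadratic_pow (m : nat) (c r b k : R) :
  is_derive (0 : R) 1
    (fun s => c * (m.+2%:R * (r + 2 * b * s + k * s ^+ 2) ^+ m.+1 * (2 * b + 2 * k * s)))
    (c * m.+2%:R * (m.+1%:R * r ^+ m * (2 * b) ^+ 2 + r ^+ m.+1 * (2 * k))).
Proof.
have i1 := is_derive_quadratic_pow m.+1 1 r b k 0.
have i2 : is_derive (0 : R) 1 (fun s => 2 * b + 2 * k * s) (2 * k).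
  have := is_derive_quadratic (2 * b) k 0 0; rewrite mulr0 addr0.
  by apply: eq_is_derive => s; rewrite mul0r addr0.
have i3 := is_deriveZ (c * m.+2%:R) (is_deriveM i1 i2).
apply: (@is_derive_eq _ _ _ _ _ _ _ _ (eq_is_derive _ i3)).
  move=> s; rewrite -[LHS]/(c * m.+2%:R *
    (1 * (r + 2 * b * s + k * s ^+ 2) ^+ m.+1 * (2 * b + 2 * k * s))); ring.
rewrite /= expr0n /= !mulr0 !addr0 !mul1r /GRing.scale /= exprS; ring.
Qed.

End QuadraticPower.

(** * Scaling, ellipticity and contact conditions for the operator *)

Section Operator.
Context {R : realType} {n : nat}.
Variables (Omega : set 'rV[R]_n) (alpha a A : R).
Variable F : 'rV[R]_n -> 'rV[R]_n -> 'M[R]_n -> R.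
Hypotheses (a_ge0 : 0 <= a).
Hypothesis F_hom : forall (t mu : R) x p X, t != 0 -> 0 <= mu -> Omega x -> p != 0 ->
  symmx X -> F x (t *: p) (mu *: X) = `|t| `^ alpha * mu * F x p X.
Hypothesis F_ell : F_elliptic Omega alpha a A F.

Lemma symmx_scalar (c : R) : symmx (c%:M : 'M[R]_n).
Proof. exact: tr_scalar_mx. Qed.

Lemma mxtrace_ge0 (Y : 'M[R]_n) : mxle 0 Y -> 0 <= \tr Y.
Proof.
move=> Y0; apply: sumr_ge0 => i _.
have := Y0 (delta_mx 0 i).
rewrite mulmx0 -rowE /dot (bigD1 i)//= !mxE big1 ?addr0 => [|j ji]; last first.
  by rewrite !mxE (negPf ji) mulr0.
rewrite mul0r (bigD1 i)//= big1 ?addr0 => [|j ji]; last first.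
  by rewrite !mxE (negPf ji) mulr0.
by rewrite !mxE !eqxx mulr1.
Qed.

(** Homogeneity with [mu = 0] gives [F x p 0 = 0]. Ellipticity applied to the increment [lam%:M - X]
    compares [X] with [lam%:M], and applied to [lam%:M] it bounds the latter by its trace. *)
Lemma F_le_scalar x p X (lam : R) : Omega x -> p != 0 -> symmx X -> 0 <= lam ->
  (forall v, dot (v *m X) v <= lam * dot v v) ->
  F x p X <= A * enorm p `^ alpha * (lam * n%:R).
Proof.
move=> Ox p0 sX lam0 Xlam.
have F0 : F x p 0 = 0.
  have := F_hom (oner_neq0 R) (lexx 0) Ox p0 sX.
  by rewrite scale1r scale0r mulr0 mul0r.
have s0 : symmx (0 : 'M[R]_n) by rewrite /symmx trmx0.
have sl := symmx_scalar lam.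
have quad v : dot (v *m (lam%:M : 'M[R]_n)) v = lam * dot v v.
  by rewrite mul_mx_scalar dotZl.
have l0 : mxle 0 (lam%:M : 'M[R]_n).
  move=> v; rewrite quad mulmx0 dot0l.
  by rewrite mulr_ge0// dot_ge0.
have [_] := andP (F_ell Ox p0 s0 sl l0).
rewrite F0 add0r subr0 mxtrace_scalar -[lam *+ n]mulr_natr => Fl.
have sd : symmx (lam%:M - X) by rewrite /symmx linearB /= sl sX.
have d0 : mxle 0 (lam%:M - X).
  move=> v; rewrite mulmx0 dot0l.
  by rewrite mulmxBr dotDl dotNl quad subr_ge0.
have [Fd _] := andP (F_ell Ox p0 sX sd d0).
rewrite [X + _]addrC subrK in Fd.
apply: (@le_trans _ _ (F x p lam%:M)); last exact: Fl.
by rewrite -subr_ge0; apply: le_trans Fd; rewrite !mulr_ge0 ?powR_ge0// mxtrace_ge0.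
Qed.

Variable h : 'rV[R]_n * R -> 'rV[R]_n.

(** Diffusion and drift share the degree [1 + alpha], so scaling a barrier makes its operator as
    negative as desired. *)
Lemma spatial_op_scale (c : R) q p X : 0 < c -> Omega q.1 -> p != 0 -> symmx X ->
  spatial_op F h alpha q (c *: p) (c *: X) =
  c `^ (1 + alpha) * spatial_op F h alpha q p X.
Proof.
move=> c0 Oq p0 sX; rewrite /spatial_op F_hom ?gt_eqF// ?ltW//.
rewrite dotZr enormZ powRM ?enorm_ge0// gtr0_norm//.
rewrite powRD ?(gt_eqF c0) ?implybT// powRr1 ?ltW//; ring.
Qed.

(* Both clauses of the definition of a supersolution at q, with the infimum of
   the degenerate clause replaced by contact with a function of time alone. *)
Definition contact_super (G : R) (w : 'rV[R]_n * R -> R) (q : 'rV[R]_n * R) : Prop :=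
  (forall phi, C2_near q phi -> touches_below phi w q ->
     grad (fun y => phi (y, q.2)) q.1 != 0 -> G <= parabolic_op F h alpha phi q) /\
  (forall chi : R -> R, derivable chi q.2 1 ->
     touches_below (fun q' => w q + (chi q'.2 - chi q.2)) w q -> G <= derive1 chi q.2).

(** A test function below [W] at [q] is also below the larger [w]. This is how an infimum inherits
    the property from a member attaining it. *)
Lemma contact_super_le G (w W : 'rV[R]_n * R -> R) q : W q = w q -> (\forall q' \near q, W q' <= w q') ->
  contact_super G w q -> contact_super G W q.
Proof.
move=> E le [c1 c2].
have tb phi : touches_below phi W q -> touches_below phi w q.
  move=> [e H]; split; first by rewrite e.
  by apply: filterS (filterI le H) => q' [Ww pW]; exact: le_trans pW Ww.
split=> [phi Cphi /tb|chi dchi]; first exact: c1.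
by rewrite E => /tb; exact: c2.
Qed.

Lemma derive1_slice_ge (phi : 'rV[R]_n * R -> R) (g : R -> R) x t (m : R) :
  C2_near (x, t) phi -> touches_below (fun s => phi (x, s)) g t ->
  (\forall s \near t, s < t -> g s - g t <= m * (s - t)) ->
  m <= derive1 (fun s => phi (x, s)) t.
Proof.
move=> /C2_nearP /nbhs_singleton [_ d1 _] [E H] gm.
apply: derive1_ge_of_left; first exact: derivable_time_slice (proj1 (d1 _)).
apply: filterS (filterI H gm) => s [le gs] st.
by apply: le_trans (gs st); rewrite /= E lerD2r.
Qed.

Lemma time_contact_ge (chi g : R -> R) (t k m : R) : derivable chi t 1 ->
  touches_below (fun s => k + (chi s - chi t)) g t ->
  (\forall s \near t, s < t -> g s - g t <= m * (s - t)) -> m <= derive1 chi t.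
Proof.
move=> dchi [E H] gm; apply: derive1_ge_of_left => //.
apply: filterS (filterI H gm) => s [le gs] st.
apply: le_trans (gs st); rewrite -E subrr addr0; move: le.
by rewrite -lerBrDl.
Qed.

(** Dividing a test function by [K] and shifting it gives a test function for [Wz]. By scaling, the
    spatial operator is at most [- K^(1 + alpha)], while contact in time bounds the time derivative
    below by [- L]. *)
Lemma lateral_contact (G K L : R) (g : R -> R) (Wz : 'rV[R]_n -> R) x t :
  0 < K -> Omega x -> G + L <= K `^ (1 + alpha) ->
  (\forall s \near t, s < t -> g s - g t <= - L * (s - t)) ->
  (forall phi, C2_near x phi -> touches_below phi Wz x -> grad phi x != 0) ->
  (forall phi, C2_near x phi -> touches_below phi Wz x ->
     spatial_op F h alpha (x, t) (grad phi x) (hess phi x) <= - 1) ->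
  contact_super G (fun q => g q.2 + K * Wz q.1) (x, t).
Proof.
move=> K0 Ox KG gL grad0 op1.
have Kn0 : K != 0 by rewrite gt_eqF.
have gL' : \forall s \near t, s < t ->
    (g s + K * Wz x) - (g t + K * Wz x) <= - L * (s - t).
  by apply: filterS gL => s gs /gs; lra.
have rescale phi : touches_below phi (fun y => g t + K * Wz y) x ->
    touches_below (fun y => K^-1 * phi y + (- (K^-1 * g t))) Wz x.
  move=> /(touches_below_affine (- (K^-1 * g t)) (ltW (etrans (invr_gt0 K) K0))).
  have E y : K^-1 * (g t + K * Wz y) - K^-1 * g t = Wz y by field.
  move=> [e H]; split; first by rewrite e E.
  by apply: filterS H => y; rewrite E.
split=> [phi Cphi tphi /= gphi|chi dchi tchi /=].
  have tm : - L <= derive1 (fun s => phi (x, s)) t.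
    exact: derive1_slice_ge Cphi (touches_below_time_slice tphi) gL'.
  have Cx := C2_near_slice Cphi.
  have := op1 _ (C2_near_affine K^-1 (- (K^-1 * g t)) Cx)
    (rescale _ (touches_below_slice tphi)).
  rewrite grad_affine// hess_affine//.
  rewrite spatial_op_scale ?invr_gt0//; last exact: symmx_hess.
  rewrite /parabolic_op /=; set S := spatial_op _ _ _ _ _ _ => SK.
  suff : S <= - (K `^ (1 + alpha)) by lra.
  have Kp : 0 < K `^ (1 + alpha) by exact: powR_gt0.
  have : K `^ (1 + alpha) * (K^-1 `^ (1 + alpha) * S) <= K `^ (1 + alpha) * - 1.
    by rewrite ler_wpM2l// ltW.
  rewrite mulrA -powRM ?invr_ge0 ?(ltW K0)// divff// powR1 mul1r mulrN1.
  exact.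
(* Contact with a function of time alone makes a constant touch [Wz] from below in space; its zero
   gradient is excluded by [grad0]. *)
exfalso; have [_ H] := rescale _ (touches_below_slice tchi).
have Cc := C2_near_cst x (Wz x).
suff /(grad0 _ Cc) : touches_below (fun=> Wz x) Wz x by rewrite grad_cst eqxx.
split=> //; apply: filterS H => y /=.
by rewrite subrr addr0 mulrDr mulrA mulVf// mul1r addrAC subrr add0r.
Qed.

(** With [rho = |x - z|], contact fixes the gradient, of size [c rho^(2m+3)], and bounds the Hessian
    above by a multiple of [rho^(2m+2)]. Hence diffusion is at most a multiple of [rho^e] with
    [e >= 0], bounded for [rho <= D], and a large time slope [M] absorbs it together with the
    drift. *)
Lemma initial_contact (G C D H : R) (m : nat) : 0 < C -> 0 <= A -> -1 < alpha ->
  0 <= (2 * m + 3)%:R * alpha + (2 * m + 2)%:R ->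
  exists B : R, forall (M k : R) (z x : 'rV[R]_n) t, B <= M -> Omega x ->
    enorm (h (x, t)) <= H -> enorm (x - z) <= D ->
  contact_super G (fun q => k + C * dot (q.1 - z) (q.1 - z) ^+ m.+2 + M * q.2) (x, t).
Proof.
move=> C0 A0 alpha1.
set e := _ + _ => e0.
(* The gradient of [C |y|^(2m+4)] is [c |y|^(2m+2) y]. [B1] and [B2] will bound the diffusion and
   the drift. *)
pose c := 2 * C * m.+2%:R.
have c0 : 0 < c by rewrite !mulr_gt0.
pose B1 := A * (c `^ alpha * c * (2 * m + 3)%:R * D `^ e * n%:R).
pose B2 := H * (c * D ^+ (2 * m + 3)) `^ (1 + alpha).
(* The second entry [G] of the maximum serves contact with functions of time alone, where the time
   derivative is at least [M]. *)
exists (Num.max (G + B1 + B2) G) => M k z x t; rewrite ge_max => /andP[BM GM] Ox hH rD.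
set w := fun q : 'rV[R]_n * R => _.
have wt : \forall s \near t, s < t -> w (x, s) - w (x, t) <= M * (s - t).
  by apply: (@filterE _ (nbhs t)) => s _; rewrite /w /=; lra.
split=> [phi Cphi tphi /= gphi|chi dchi tchi /=]; last first.
  apply: le_trans GM _.
  exact: (time_contact_ge dchi (touches_below_time_slice tchi) wt).
have tm : M <= derive1 (fun s => phi (x, s)) t.
  exact: derive1_slice_ge Cphi (touches_below_time_slice tphi) wt.
have Cx := C2_near_slice Cphi.
set f := (fun y => phi (y, t)) in Cx *.
have tf : touches_below f (fun y => w (y, t)) x := touches_below_slice tphi.
pose r := dot (x - z) (x - z).
have line v : 'D_v f x = c * r ^+ m.+1 * dot (x - z) v /\
    'D_v ('D_v f) x <= c * (2 * m + 3)%:R * r ^+ m.+1 * dot v v.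
  have /C2_nearP H2 := Cx; have [_ _ d2] := nbhs_singleton H2.
  have d1 : \forall y \near x, derivable f y v.
    by apply: filterS H2 => y [_ d1 _]; exact: (proj1 (d1 v)).
  have dw (s : R) := is_deriveD (is_derive_quadratic_pow m.+2 C r (dot (x - z) v) (dot v v) s)
    (is_derive_cst (k + M * t) s 1).
  have [|E1 E2] := contact_line tf d1 (proj1 (d2 v v)) _
    (is_derive2_quadratic_pow m C r (dot (x - z) v) (dot v v)).
    move=> s; have := dw s; rewrite addr0; apply: eq_is_derive => s'.
    rewrite /w /=; have -> : dot (x + s' *: v - z) (x + s' *: v - z) =
        r + 2 * dot (x - z) v * s' + dot v v * s' ^+ 2.
      rewrite addrAC /r; move: (x - z) => d.
      by rewrite !(dotDl, dotDr, dotZl, dotZr) (dotC v); ring.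
    by rewrite -[LHS]/(C * (r + 2 * dot (x - z) v * s' + dot v v * s' ^+ 2) ^+ m.+2
      + (k + M * t)) addrCA addrA.
  rewrite E1; split; first by rewrite !mulr0 expr0n /= mulr0 !addr0 /c; ring.
  apply: le_trans E2 _.
  (* Cauchy-Schwarz absorbs the rank-one part of the second derivative, which carries
     [dot (x - z) v ^+ 2], into [r ^+ m.+1 * dot v v]. *)
  have cs := dot_sqr (x - z) v; rewrite -/r in cs.
  have r0 : 0 <= r by exact: dot_ge0.
  have : r ^+ m * dot (x - z) v ^+ 2 <= r ^+ m.+1 * dot v v.
    by rewrite [r ^+ m.+1]exprSr -mulrA ler_wpM2l ?exprn_ge0.
  set b := dot _ v; set kk := dot v v => cs'.
  have m0 : 0 <= C * m.+2%:R * m.+1%:R * 4 by rewrite !mulr_ge0// ltW.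
  have := ler_wpM2l m0 cs'; rewrite -subr_ge0 => cs2; rewrite -subr_ge0.
  apply: le_trans cs2 _; rewrite le_eqVlt; apply/orP; left; apply/eqP.
  by rewrite /c natrD natrM -!natr1; ring.
have gradE : grad f x = (c * r ^+ m.+1) *: (x - z).
  apply/rowP => i; rewrite !mxE (proj1 (line _)); congr (_ * _).
  rewrite /dot (bigD1 i)//= big1 ?addr0 => [|j ji]; last by rewrite !mxE (negPf ji) mulr0.
  by rewrite !mxE !eqxx mulr1.
clearbody c.
(* A nonzero gradient forces [x != z]; positivity of [rho] is what permits adding real exponents
   when [alpha] may be negative. *)
have rho0 : enorm (x - z) != 0.
  apply: contra gphi; rewrite enorm_eq0 => /eqP xz; apply/eqP.
  by rewrite -/f gradE xz scaler0.
set rho := enorm (x - z) in rD rho0.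
have rhop : 0 < rho by rewrite lt_def rho0 enorm_ge0.
have rE : r = rho ^+ 2 by rewrite enorm_sqr.
have pE : enorm (grad f x) = c * rho ^+ (2 * m + 3).
  rewrite gradE enormZ gtr0_norm ?mulr_gt0 ?exprn_gt0 ?rE ?exprn_gt0//.
  rewrite -exprM -/rho -mulrA -exprSr; congr (_ * _ ^+ _).
  by rewrite mulnS addn3 add2n.
have bF : F x (grad f x) (hess f x) <= B1.
  have lam0 : 0 <= c * (2 * m + 3)%:R * r ^+ m.+1.
    by rewrite !mulr_ge0 ?exprn_ge0 ?dot_ge0 ?(ltW c0).
  have H1 := @F_le_scalar x (grad f x) (hess f x) (c * (2 * m + 3)%:R * r ^+ m.+1) Ox gphi
    (symmx_hess Cx) lam0.
  apply: (le_trans (H1 _)).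
    by move=> v; rewrite hess_quadratic//; exact: (proj2 (line v)).
  rewrite /B1 -mulrA ler_wpM2l// pE powRM ?exprn_ge0 ?(ltW c0) ?(ltW rhop)//.
  have -> : c `^ alpha * (rho ^+ (2 * m + 3)) `^ alpha * (c * (2 * m + 3)%:R * r ^+ m.+1 * n%:R)
    = c `^ alpha * c * (2 * m + 3)%:R * ((rho ^+ (2 * m + 3)) `^ alpha * r ^+ m.+1) * n%:R.
    by ring.
  rewrite ler_wpM2r// ler_wpM2l ?mulr_ge0 ?powR_ge0 ?(ltW c0)//.
  rewrite rE -exprM -!powR_mulrn ?(ltW rhop)// -powRrM -powRD ?rho0 ?implybT//.
  have -> : (2 * m + 3)%:R * alpha + (2 * m.+1)%:R = e :> R.
    by rewrite /e [(2 * m.+1)%N]mulnS [(2 + _)%N]addnC.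
  by apply: ge0_ler_powR => //; rewrite nnegrE ltW// (lt_le_trans rhop).
have D0 : 0 <= D by rewrite (le_trans _ rD)// ltW.
have bh : dot (h (x, t)) (grad f x) * enorm (grad f x) `^ alpha <= B2.
  apply: (@le_trans _ _ (H * enorm (grad f x) * enorm (grad f x) `^ alpha)).
    rewrite ler_wpM2r ?powR_ge0//; apply: le_trans (dot_le_enorm _ _) _.
    by rewrite ler_wpM2r ?enorm_ge0.
  have pp : 0 < enorm (grad f x) by rewrite lt_def enorm_eq0 gphi enorm_ge0.
  rewrite -mulrA -[X in _ * (X * _)]powRr1 ?(ltW pp)// -powRD ?(gt_eqF pp) ?implybT//.
  rewrite /B2 ler_wpM2l ?(le_trans (enorm_ge0 _) hH)//.
  apply: ge0_ler_powR; rewrite ?nnegrE ?enorm_ge0 ?mulr_ge0 ?exprn_ge0 ?(ltW c0)//; first lra.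
  by rewrite pE ler_wpM2l ?(ltW c0)// lerXn2r// nnegrE// ltW.
by rewrite /parabolic_op /spatial_op /= -/f; lra.
Qed.

End Operator.

(** * Infimum of a locally finite family *)

Section ProductNear.
Context {R : realType} {V : normedModType R}.

Lemma near_fst (P : V -> Prop) (q : V * R) : (\forall x \near q.1, P x) ->
  \forall q' \near q, P q'.1.
Proof. by case: q => x t H; exact: (@cvg_fst _ _ (nbhs x) (nbhs t) _ _ H). Qed.

Lemma near_snd (P : R -> Prop) (q : V * R) : (\forall t \near q.2, P t) ->
  \forall q' \near q, P q'.2.
Proof. by case: q => x t H; exact: (@cvg_snd _ _ (nbhs x) (nbhs t) _ _ H). Qed.

End ProductNear.

(** * From contact conditions to viscosity solutions *)

Section ContactSolutions.
Context {R : realType} {n : nat}.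
Variables (Omega : set 'rV[R]_n) (T alpha G : R).
Variable F : 'rV[R]_n -> 'rV[R]_n -> 'M[R]_n -> R.
Variable h : 'rV[R]_n * R -> 'rV[R]_n.

(** In the degenerate clause the locally constant infimum [k] is at least [W (x, t)] by minimality
    at [x]. So [W (y, s) - phi s >= W (x, t)] for all nearby [(y, s)], which is contact with a
    function of time alone. *)
Lemma contact_supersolution W : {within cylinder Omega T, continuous W} ->
  (forall q, cylinder Omega T q -> contact_super alpha F h G W q) ->
  supersolution Omega T alpha F h (fun=> G) W.
Proof.
move=> cW con; split=> // x t Ox tT; have [c1 c2] := con (x, t) (conj Ox tT).
split=> [phi Cphi tphi|d phi d0 _ Cphi phi0 mint [k infk]]; first exact: c1.
apply: c2 => /=.
  have [_ d1 _] := Cphi t (ballxx t d0); exact: (proj1 (d1 1)).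
split; first by rewrite /= phi0 subrr addr0.
have kW : ((W (x, t))%:E <= k)%E.
  rewrite -(nbhs_singleton infk); apply: le_ereal_inf_tmp => _ [s ts <-].
  by rewrite lee_fin; exact: mint.
have nx := @near_fst R _ _ (x, t) infk.
have nt := @near_snd R 'rV[R]_n (fun s => ball t d s) (x, t) (nbhsx_ballx t d d0).
apply: filterS (filterI nx nt) => -[y s] /= [infy ts].
rewrite phi0 subr0 -lerBrDr -lee_fin; apply: le_trans kW _; rewrite -infy.
by apply: ereal_inf_lbound; exists s.
Qed.

(** A test function above [- W] is the negative of one below [W]. The sign changes inside the dual
    operator and the oddness of the drift turn one inequality into the other. *)
Lemma contact_subsolution W : {within cylinder Omega T, continuous W} ->
  (forall q, cylinder Omega T q ->
     contact_super alpha (fun x p X => - F x (- p) (- X)) h G W q) ->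
  subsolution Omega T alpha F h (fun=> - G) (fun q => - W q).
Proof.
move=> cW con; split; first by move=> q; apply: cvgN; exact: cW.
move=> x t Ox tT; have [c1 c2] := con (x, t) (conj Ox tT).
split=> [phi Cphi [E tphi] gphi|d phi d0 _ Cphi phi0 maxt [k supk]].
  have Cx := C2_near_slice Cphi.
  have := c1 (fun q => -1 * phi q + 0) (C2_near_affine _ _ Cphi).
  rewrite /parabolic_op /spatial_op /= grad_affine// hess_affine// !scaleN1r !opprK.
  rewrite oppr_eq0 gphi enormN dotNr => /(_ _ isT).
  rewrite !derive1E derive_affine; last first.
    move/C2_nearP : Cphi => /nbhs_singleton [_ d1 _].
    exact: derivable_time_slice (proj1 (d1 _)).
  move=> H; suff /H : touches_below (fun q => -1 * phi q + 0) W (x, t) by lra.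
  split; first by rewrite E; ring.
  by apply: filterS tphi => q; lra.
have dphi : derivable phi t 1.
  by have [_ d1 _] := Cphi t (ballxx t d0); exact: (proj1 (d1 1)).
have i := is_derive_affine (-1) 0 (derivableP dphi).
have := c2 (fun s => -1 * phi s + 0) (@ex_derive _ _ _ _ _ _ _ i).
rewrite /= !derive1E (@derive_val _ _ _ _ _ _ _ i) => H.
suff /H : touches_below (fun q' => W (x, t) + (-1 * phi q'.2 + 0 - (-1 * phi t + 0))) W (x, t).
  by lra.
split; first by rewrite /= subrr addr0.
have kW : (k <= (- W (x, t))%:E)%E.
  rewrite -(nbhs_singleton supk); apply: ge_ereal_sup => _ [s ts <-].
  by rewrite lee_fin; exact: maxt.
have nx := @near_fst R _ _ (x, t) supk.
have nt := @near_snd R 'rV[R]_n (fun s => ball t d s) (x, t) (nbhsx_ballx t d d0).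
apply: filterS (filterI nx nt) => -[y s] /= [supy ts].
have : ((- W (y, s) - phi s)%:E <= (- W (x, t))%:E)%E.
  apply: le_trans kW; rewrite -supy.
  by apply: ereal_sup_ubound; exists s.
by rewrite lee_fin phi0; lra.
Qed.

End ContactSolutions.

(** * Attained and continuous infima of layered families *)

Section LocallyFiniteInf.
Context {R : realType} {Q : topologicalType}.
Variables (s : nat -> seq (Q -> R)) (S : set Q).

Definition layered : set (Q -> R) := [set w | exists k, w \in s k].
(** The real [inf] is a true infimum where the nonempty family is bounded below, which [layered_lb]
    grants on [S]. *)
Definition layered_inf (q : Q) : R := inf [set w q | w in layered].

Hypothesis layered_cont : forall w, layered w -> forall q, S q -> {for q, continuous w}.
Hypothesis layered_lb : forall q, S q -> has_lbound [set w q | w in layered].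

Lemma layered_inf_le w q : S q -> layered w -> layered_inf q <= w q.
Proof. by move=> Sq fw; apply: ge_inf; [exact: layered_lb|exists w]. Qed.

Lemma le_layered_inf q b : layered !=set0 -> (forall w, layered w -> b <= w q) ->
  b <= layered_inf q.
Proof.
move=> [w fw] H; apply: lb_le_inf; first by exists (w q); exists w.
by move=> _ [w' fw' <-]; exact: H.
Qed.

Lemma seq_min (l : seq (Q -> R)) q w0 : w0 \in l ->
  exists2 w, w \in l & forall w', w' \in l -> w q <= w' q.
Proof.
elim: l w0 => // a l IH w0 _; case: l IH => [_|b l IH].
  by exists a; rewrite ?inE// => w'; rewrite inE => /eqP ->.
have [w wl wm] := IH b (mem_head _ _).
have [aw|wa] := leP (a q) (w q).
  exists a; first exact: mem_head.
  by move=> w'; rewrite inE => /orP[/eqP ->//|/wm]; exact: le_trans.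
exists w; first by rewrite inE wl orbT.
by move=> w'; rewrite inE => /orP[/eqP ->|/wm//]; exact: ltW.
Qed.

Lemma near_seq (l : seq (Q -> R)) (q : Q) (P : (Q -> R) -> Q -> Prop) :
  (forall w, w \in l -> \forall q' \near q, P w q') ->
  \forall q' \near q, forall w, w \in l -> P w q'.
Proof.
elim: l => [|a l IH] H; first by apply: (@filterE _ (nbhs q)).
have Ha := H a (mem_head _ _).
have Hl : \forall q' \near q, forall w, w \in l -> P w q'.
  by apply: IH => w wl; apply: H; rewrite inE wl orbT.
apply: filterS (filterI Ha Hl) => q' [Pa Pl] w; rewrite inE => /orP[/eqP ->//|]; exact: Pl.
Qed.

(** Growth linear in [k], uniform near [q], pushes all late layers above one fixed member [w0]. The
    infimum is then governed near [q] by a finite list of continuous functions. *)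
Lemma layered_inf_locally_finite q : S q -> (\forall q' \near q, S q') ->
  layered !=set0 ->
  (exists m b, 0 < m /\
     \forall q' \near q, forall k w, w \in s k -> b + k%:R * m <= w q') ->
  (exists2 w, layered w & layered_inf q = w q) /\ {for q, continuous layered_inf}.
Proof.
move=> Sq nS f0 [m [b [m0 blow]]]; have [w0 [k0 w0k]] := f0.
have fw0 : layered w0 by exists k0.
(* Layers of index at least [N] lie above [w0 q + 1], hence above [w0] in a neighbourhood of [q];
   taking layers up to [k0] as well puts [w0] into the list. *)
pose N := (Num.Def.truncn `|(w0 q + 1 - b) / m|).+1.
have Nm : w0 q + 1 <= b + N%:R * m.
  rewrite -lerBlDl -ler_pdivrMr//; apply: le_trans (ler_norm _) _.
  by apply: ltW; exact: truncnS_gt.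
pose l := flatten [seq s k | k <- iota 0 (maxn N k0.+1)].
have lf w : w \in l -> layered w.
  by move=> /flatten_mapP[k _ wk]; exists k.
have kl k w : (k < maxn N k0.+1)%N -> w \in s k -> w \in l.
  by move=> kN wk; apply/flatten_mapP; exists k; rewrite // mem_iota.
have w0l : w0 \in l by apply: kl w0k; rewrite leq_max ltnS leqnn orbT.
have big : \forall q' \near q, forall w, layered w -> w \in l \/ w0 q' <= w q'.
  have n0 : \forall q' \near q, w0 q' <= w0 q + 1.
    by apply: (cvgr_le _ (layered_cont fw0 Sq)); rewrite ltrDl.
  apply: filterS (filterI n0 blow) => q' [w0q' bq'] w [k wk].
  have [kN|Nk] := ltnP k (maxn N k0.+1); first by left; exact: kl wk.
  right; apply: le_trans w0q' _; apply: le_trans Nm _; apply: le_trans (bq' k w wk).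
  by rewrite lerD2l ler_wpM2r ?(ltW m0)// ler_nat (leq_trans (leq_maxl _ _) Nk).
have [w1 w1l w1m] := seq_min q w0l.
have w1E : layered_inf q = w1 q.
  apply/eqP; rewrite eq_le layered_inf_le//=; last exact: lf.
  apply: le_layered_inf => // w fw.
  have [/w1m//|] := nbhs_singleton big w fw.
  by apply: le_trans; exact: w1m.
split; first by exists w1 => //; exact: lf.
apply/cvgrPdist_le => e e0.
have close : \forall q' \near q, forall w, w \in l -> `|w q - w q'| <= e.
  apply: near_seq => w wl.
  by have /cvgrPdist_le := layered_cont (lf _ wl) Sq; apply.
apply: filterS (filterI nS (filterI big close)) => q' [Sq' [bigq' closeq']].
have le1 : layered_inf q' <= layered_inf q + e.
  apply: le_trans (layered_inf_le Sq' (lf _ w1l)) _; rewrite w1E.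
  by have := closeq' _ w1l; rewrite ler_norml; lra.
have lel w : w \in l -> layered_inf q - e <= w q'.
  move=> wl; have := closeq' _ wl; have := w1m _ wl; rewrite -w1E ler_norml; lra.
have le2 : layered_inf q - e <= layered_inf q'.
  apply: le_layered_inf => // w fw; have [/lel//|] := bigq' w fw.
  by apply: le_trans; exact: lel.
by rewrite ler_norml; lra.
Qed.

End LocallyFiniteInf.

(** * Layers of barriers *)

Section Construction.
Context {R : realType} {n : nat}.
Variables (Omega : set 'rV[R]_n) (T alpha a A gamma G c L Mh cb Cb : R).
Variable F : 'rV[R]_n -> 'rV[R]_n -> 'M[R]_n -> R.
Variable h : 'rV[R]_n * R -> 'rV[R]_n.
Variable psi : 'rV[R]_n * R -> R.
Variable Wb : 'rV[R]_n -> 'rV[R]_n -> R.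

Hypotheses (a_ge0 : 0 <= a) (A_ge0 : 0 <= A) (alpha_gt : -1 < alpha).
Hypotheses (gamma_itv : 0 < gamma <= 1) (c_ge0 : 0 <= c) (L_ge0 : 0 <= L).
Hypotheses (cb_gt0 : 0 < cb) (cCb : cb <= Cb).
Hypotheses (oO : open Omega) (O0 : Omega !=set0) (bO : bounded_set Omega).
Hypothesis F_hom : forall (t mu : R) x p X, t != 0 -> 0 <= mu -> Omega x -> p != 0 ->
  symmx X -> F x (t *: p) (mu *: X) = `|t| `^ alpha * mu * F x p X.
Hypothesis F_ell : F_elliptic Omega alpha a A F.
Hypothesis h_bnd : forall q, cylinder Omega T q -> enorm (h q) <= Mh.
Hypothesis psi_lh : forall x t y s,
  pboundary Omega T (x, t) -> pboundary Omega T (y, s) ->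
  `|psi (x, t) - psi (y, s)| <= c * enorm (x - y) `^ gamma + L * `|t - s|.
Hypothesis Wb_cont : forall z, boundary Omega z ->
  {within closure Omega, continuous (Wb z)}.
Hypothesis Wb_bnd : forall z x, boundary Omega z -> Omega x ->
  cb * enorm (x - z) `^ gamma <= Wb z x <= Cb * enorm (x - z) `^ gamma.
Hypothesis Wb_grad : forall z x phi, boundary Omega z -> Omega x -> C2_near x phi ->
  touches_below phi (Wb z) x -> grad phi x != 0.
Hypothesis Wb_op : forall z x t phi, boundary Omega z -> 0 < t < T -> Omega x ->
  C2_near x phi -> touches_below phi (Wb z) x ->
  spatial_op F h alpha (x, t) (grad phi x) (hess phi x) <= - 1.

Local Notation cyl := (cylinder Omega T).
Local Notation pbd := (pboundary Omega T).

Let gamma_gt0 : 0 < gamma. Proof. by case/andP: gamma_itv. Qed.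

Lemma near_cylinder q : cyl q -> \forall q' \near q, cyl q'.
Proof.
move=> [Oq /andP[t0 tT]].
have n1 := near_fst (open_nbhs_nbhs (conj oO Oq)).
have n2 : \forall t \near q.2, 0 < t < T.
  by apply: filterS (filterI (lt_nbhsr t0) (lt_nbhsl tT)) => t [? ?]; apply/andP.
by apply: filterS (filterI n1 (near_snd n2)) => q' [].
Qed.

Lemma pboundary_not_cylinder q : pbd q -> ~ cyl q.
Proof.
move=> [[[_ bq] _]|[_ q0]] [Oq]; last by rewrite q0 ltxx.
by move=> _; apply: bq; exact: open_nbhs_nbhs (conj oO Oq).
Qed.

Lemma boundary_notin z : boundary Omega z -> ~ Omega z.
Proof. by move=> [_ bz] Oz; apply: bz; exact: open_nbhs_nbhs (conj oO Oz). Qed.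

Lemma bounded_boundary : bounded_set (boundary Omega).
Proof.
have [M [Mr HM]] := bO.
exists (M + 1); split; first exact: num_real.
move=> r Mr' x [clx _] /=.
have [y [Oy]] := clx _ (nbhsx_ballx x (r - (M + 1)) (etrans (subr_gt0 _ _) Mr')).
rewrite -ball_normE /= => xy.
have -> : x = y + (x - y) by rewrite addrC subrK.
apply: le_trans (ler_normD _ _) _.
have := HM (M + 1) _ y Oy; rewrite ltrDl ltr01 => /(_ isT) /=; lra.
Qed.

(** For an exponent at most one the power of the distance still obeys the triangle inequality, so
    Hölder bounds can be chained through an intermediate point. *)
Lemma enorm_gamma_le (x y z : 'rV[R]_n) :
  enorm (x - z) `^ gamma <= enorm (x - y) `^ gamma + enorm (y - z) `^ gamma.
Proof.
apply: le_trans (powR_subadd (enorm_ge0 _) (enorm_ge0 _) gamma_itv).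
apply: ge0_ler_powR; rewrite ?nnegrE ?addr_ge0 ?enorm_ge0 ?(ltW gamma_gt0)//.
exact: enorm_dist.
Qed.

Lemma near_modulus (q : 'rV[R]_n * R) (e : R) : 0 < e ->
  \forall q' \near q, c * enorm (q'.1 - q.1) `^ gamma + L * `|q'.2 - q.2| <= e.
Proof.
move=> e0; have e2 : 0 < e / 2 by rewrite divr_gt0.
have c1 : 0 < c + 1 by rewrite ltr_wpDl.
have L1 : 0 < L + 1 by rewrite ltr_wpDl.
have [d d0 H] := powR_small gamma_gt0 (divr_gt0 e2 c1).
have n1 := near_fst (near_enorm_lt q.1 d0).
have n2 : \forall t \near q.2, `|t - q.2| < e / 2 / (L + 1).
  have := nbhsx_ballx q.2 _ (divr_gt0 e2 L1); rewrite -ball_normE.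
  by apply: filterS => t /=; rewrite distrC.
apply: filterS (filterI n1 (near_snd n2)) => q' [x1 /ltW t1].
rewrite [leRHS](splitr e); apply: lerD.
  apply: (@le_trans _ _ ((c + 1) * enorm (q'.1 - q.1) `^ gamma)).
    by rewrite ler_wpM2r ?powR_ge0// lerDl.
  by rewrite mulrC -ler_pdivlMr// H// enorm_ge0 ltW.
apply: (@le_trans _ _ ((L + 1) * `|q'.2 - q.2|)); first by rewrite ler_wpM2r// lerDl.
by rewrite mulrC -ler_pdivlMr.
Qed.

(* [m] is a lower bound for the growth rate in [k] of the barriers of layer [k]
   at [q]; it is positive in the cylinder, and [m = 0] is the bound up to the boundary. *)
Definition layer_lower (k : nat) (w : 'rV[R]_n * R -> R) : Prop :=
  forall q m, cyl q -> m <= q.2 ->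
    (forall z, boundary Omega z -> m <= cb * enorm (q.1 - z) `^ gamma) ->
  forall y s, pbd (y, s) ->
  psi (y, s) - (c * enorm (q.1 - y) `^ gamma + L * `|q.2 - s|) + k%:R * m <= w q.

Definition barrier_of_layer (k : nat) (w : 'rV[R]_n * R -> R) : Prop :=
  [/\ forall q, cyl q -> {for q, continuous w},
      forall q, cyl q -> contact_super alpha F h G w q & layer_lower k w].

(** The three entries ensure positivity, the operator bound [slope_op] and, through [slope_bnd],
    that the barrier dominates the spatial modulus of [psi]. *)
Definition slope : R :=
  Num.max 1 (Num.max ((`|G| + L + 1) `^ (1 + alpha)^-1) (c / cb)).

Lemma slope_gt0 k : 0 < slope + k%:R.
Proof. by rewrite ltr_pwDl// /slope lt_max ltr01. Qed.

Lemma slope_op k : G + L <= (slope + k%:R) `^ (1 + alpha).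
Proof.
have a1 : 0 < 1 + alpha by rewrite -ltrBlDl sub0r.
have g0 : 0 <= `|G| + L + 1 by rewrite !addr_ge0.
apply: (@le_trans _ _ (`|G| + L + 1)).
  by have := ler_norm G; lra.
have -> : `|G| + L + 1 = ((`|G| + L + 1) `^ (1 + alpha)^-1) `^ (1 + alpha).
  by rewrite -powRrM mulVf ?powRr1// lt0r_neq0.
apply: ge0_ler_powR; rewrite ?nnegrE ?powR_ge0 ?(ltW a1) ?(ltW (slope_gt0 k))//.
apply: ler_wpDr => //; rewrite /slope le_max; apply/orP; right.
by rewrite le_max lexx.
Qed.

Lemma slope_bnd : c <= slope * cb.
Proof. by rewrite -ler_pdivrMr// /slope !le_max lexx !orbT. Qed.

Lemma psi_lower x t y s : pbd (x, t) -> pbd (y, s) ->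
  psi (y, s) - (c * enorm (x - y) `^ gamma + L * `|t - s|) <= psi (x, t).
Proof. by move=> px py; have := psi_lh px py; rewrite ler_norml; lra. Qed.

(** The [slope] part of the multiple of [Wb z] pays for the Hölder distance from [x] to [z], and the
    part [k%:R] supplies the growth in [k]. The Lipschitz constant of [psi] in time is the [L]
    absorbed by [slope_op]. *)
Lemma lateral_barrier k z : boundary Omega z ->
  barrier_of_layer k (fun q => psi (z, q.2) + (slope + k%:R) * Wb z q.1).
Proof.
(* In the lower bound [py], [pz] stand for values of [psi]; [zy], [xz], [xy] for Hölder terms; [l]
   for the time term; [sW], [kW] for the two parts of the barrier. *)
have arith (py pz zy xz xy l km kW sW : R) : py - (zy + l) <= pz -> km <= kW ->
    xz <= sW -> zy <= xz + xy -> py - (xy + l) + km <= pz + (sW + kW).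
  by lra.
move=> bz; have K0 := slope_gt0 k.
have psit t t' : 0 < t < T -> 0 < t' < T -> `|psi (z, t) - psi (z, t')| <= L * `|t - t'|.
  move=> tT tT'; have := psi_lh (or_introl (conj bz tT)) (or_introl (conj bz tT')).
  by rewrite subrr enorm0 powR0 ?gt_eqF// mulr0 add0r.
have nT t : 0 < t < T -> \forall t' \near t, 0 < t' < T.
  move=> /andP[t0 tT].
  by apply: filterS (filterI (lt_nbhsr t0) (lt_nbhsl tT)) => t' [? ?]; apply/andP.
split.
- move=> -[x t] [/= Ox tT].
  have c1 : {for t, continuous (fun t => psi (z, t))}.
    apply/cvgrPdist_le => e e0; have L1 : 0 < L + 1 by rewrite ltr_wpDl.
    have := nbhsx_ballx t _ (divr_gt0 e0 L1); rewrite -ball_normE => nb.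
    apply: filterS (filterI nb (nT t tT)) => t' [/= /ltW tt' tT'].
    apply: le_trans (psit _ _ tT tT') _.
    apply: (@le_trans _ _ ((L + 1) * `|t - t'|)); first by rewrite ler_wpM2r// lerDl.
    by rewrite mulrC -ler_pdivlMr.
  have c2 : {for x, continuous (Wb z)}.
    have /subspace_continuousP := Wb_cont bz => /(_ x (subset_closure Ox)) W1.
    have nx : \forall y \near x, closure Omega y.
      apply: filterS (open_nbhs_nbhs (conj oO Ox)); exact: subset_closure.
    move=> U /W1 WU.
    have WU' : \forall y \near x, closure Omega y -> U (Wb z y) by exact: WU.
    by apply: filterS (filterI nx WU') => y [cy]; exact.
  apply: (@cvgD _ _ _ (nbhs (x, t))).
    exact: (@continuous_comp _ _ _ snd (fun t => psi (z, t)) (x, t) (@cvg_snd _ _ _ _ _) c1).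
  apply: (@cvgM _ _ (nbhs (x, t))); first exact: cvg_cst.
  exact: (@continuous_comp _ _ _ fst (Wb z) (x, t) (@cvg_fst _ _ _ _ _) c2).
- move=> -[x t] [/= Ox tT].
  apply: (lateral_contact F_hom (g := fun t => psi (z, t)) (Wz := Wb z) K0 Ox
    (slope_op k)) => [|phi|phi].
  + apply: filterS (nT t tT) => s sT st.
    have := psit s t sT tT; rewrite ler_norml ltr0_norm ?subr_lt0//; lra.
  + exact: Wb_grad.
  + exact: Wb_op.
- move=> [x t] m [/= Ox tT] mt mz y s ys.
  have [W1 _] := andP (Wb_bnd bz Ox).
  have p1 := psi_lower (or_introl (conj bz tT)) ys.
  have e0 : 0 <= enorm (x - z) `^ gamma by exact: powR_ge0.
  have k1 : k%:R * m <= k%:R * Wb z x.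
    by rewrite ler_wpM2l//; apply: le_trans W1; exact: mz.
  have k2 : c * enorm (x - z) `^ gamma <= slope * Wb z x.
    apply: (@le_trans _ _ (slope * cb * enorm (x - z) `^ gamma)).
      by rewrite ler_wpM2r// slope_bnd.
    rewrite -mulrA ler_wpM2l//; have := slope_gt0 0; rewrite addr0; exact: ltW.
  have k3 : c * enorm (z - y) `^ gamma <=
      c * enorm (x - z) `^ gamma + c * enorm (x - y) `^ gamma.
    by rewrite -mulrDr ler_wpM2l// (enormB x z); exact: enorm_gamma_le.
  by rewrite /= mulrDl; exact: arith p1 k1 k2 k3.
Qed.

(** The accuracy of layer [k], which tends to [0]; the shift to [k.+1] keeps it meaningful at
    [k = 0]. *)
Definition eta (k : nat) : R := (k.+1%:R)^-1.

Lemma eta_gt0 k : 0 < eta k.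
Proof. by rewrite invr_gt0. Qed.

(** For fixed [k] the slope is fixed, so the common upper bound [Cb |x - z|^gamma] makes every
    barrier small near its vertex at one common scale. One [eta k] pays for space, the other for
    time. *)
Lemma lateral_net k : exists2 Z : seq 'rV[R]_n, (forall z, z \in Z -> boundary Omega z) &
  forall y s, boundary Omega y -> 0 < s < T -> exists2 z, z \in Z &
    \forall q \near (y, s), cyl q ->
      psi (z, q.2) + (slope + k%:R) * Wb z q.1 <= psi (y, s) + 2 * eta k.
Proof.
have arith (py pz W zy l cB KB e : R) : pz - py <= zy + l -> W <= KB -> zy <= cB ->
    cB + KB <= e -> l <= e -> pz + W <= py + 2 * e.
  by lra.
have K0 := slope_gt0 k.
(* [B] collects the Hölder constant of [psi] and the steepness of the barriers; within distance [d]
   their joint contribution is at most [eta k]. *)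
pose B := c + (slope + k%:R) * Cb.
have Cb0 : 0 <= Cb by rewrite (le_trans _ cCb)// ltW.
have B0 : 0 < B + 1 by rewrite ltr_wpDl// addr_ge0// mulr_ge0// ltW.
have [d d0 Hd] := powR_small gamma_gt0 (divr_gt0 (eta_gt0 k) B0).
have d2 : 0 < d / 2 by rewrite divr_gt0.
have [Z ZS Znet] := finite_net bounded_boundary d2.
exists Z => // y s by_ sT; have [z zZ yz] := Znet y by_.
exists z => //.
have n1 := @near_fst R _ (fun x => enorm (x - y) < d / 2) (y, s) (near_enorm_lt y d2).
have n2 := near_modulus (y, s) (eta_gt0 k).
apply: filterS (filterI n1 n2) => -[x t] /= [xy mod_] [/= Ox tT].
have [_ W2] := andP (Wb_bnd (ZS _ zZ) Ox).
have := psi_lh (or_introl (conj (ZS _ zZ) tT)) (or_introl (conj by_ sT)).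
rewrite ler_norml => /andP[_ p1].
have xz : enorm (x - z) <= d.
  by apply: le_trans (enorm_dist y _ _) _; rewrite [leRHS]splitr lerD// ltW.
have e1 : enorm (x - z) `^ gamma <= eta k / (B + 1) by rewrite Hd// enorm_ge0.
have e2 : enorm (z - y) `^ gamma <= eta k / (B + 1).
  rewrite Hd// enorm_ge0 enormB (le_trans (ltW yz))// ler_pdivrMr//.
  by rewrite ler_pMr// ler1n.
have W3 : (slope + k%:R) * Wb z x <= (slope + k%:R) * Cb * (eta k / (B + 1)).
  rewrite -mulrA ler_wpM2l ?(ltW K0)//; apply: le_trans W2 _.
  exact: ler_wpM2l Cb0 _ _ e1.
have p2 : c * enorm (z - y) `^ gamma <= c * (eta k / (B + 1)) by rewrite ler_wpM2l.
have BE : c * (eta k / (B + 1)) + (slope + k%:R) * Cb * (eta k / (B + 1)) <= eta k.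
  rewrite -mulrDl -/B mulrCA ler_piMr ?(ltW (eta_gt0 k))//.
  by rewrite ler_pdivrMr// mul1r lerDl.
have : L * `|t - s| <= eta k.
  by apply: le_trans mod_; rewrite lerDr mulr_ge0// powR_ge0.
exact: arith p1 W3 p2 BE.
Qed.

(** The offset [eta k] plus the smooth power dominates the Hölder modulus, which gives the lower
    bound. Near a net point the four errors are the variation of [psi], the offset, the power and
    the time term, each at most [eta k]. *)
Lemma initial_layer (D : R) (m k : nat) :
  (forall x y, Omega x -> Omega y -> enorm (x - y) <= D) ->
  0 <= (2 * m + 3)%:R * alpha + (2 * m + 2)%:R ->
  exists l : seq ('rV[R]_n * R -> R), (forall w, w \in l -> barrier_of_layer k w) /\
    forall y, Omega y -> exists2 w, w \in l &
    \forall q \near (y, 0), cyl q -> w q <= psi (y, 0) + 4 * eta k.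
Proof.
have arith_lower (py pz zy xz xy l l0 kr e Cx Mt Lt kt : R) : py - (zy + l0) <= pz ->
    xz <= e + Cx -> zy <= xz + xy -> Lt + kt <= Mt -> kr <= kt -> l0 <= Lt + l ->
    py - (xy + l) + kr <= pz + e + Cx + Mt.
  by lra.
have arith_upper (py pz cx Cx mt e : R) : pz - py <= cx -> Cx <= e -> cx <= e -> mt <= e ->
    pz + e + Cx + mt <= py + 4 * e.
  by lra.
move=> diam alpham.
have e0 := eta_gt0 k.
have [C C0 HC] := powR_le_small_add_pow gamma_itv (ltn0Sn (2 * m.+2).-1) c_ge0 e0.
have [B HB] := initial_contact a_ge0 F_hom F_ell h G D Mh C0 A_ge0 alpha_gt alpham.
(* [B] settles the operator inequality; [L + k%:R] covers the variation of [psi] in time and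
   supplies the growth in [k]. *)
pose M := Num.max B (L + k%:R).
have M0 : 0 <= M by rewrite /M le_max addr_ge0 ?orbT.
have LM : L + k%:R <= M by rewrite le_max lexx orbT.
have [d d0 Hd] : exists2 d : R, 0 < d & forall r, 0 <= r <= d ->
    c * r `^ gamma <= eta k /\ C * r ^+ (2 * m.+2) <= eta k.
  have c1 : 0 < c + 1 by rewrite ltr_wpDl.
  have [d1 d10 H1] := powR_small gamma_gt0 (divr_gt0 e0 c1).
  have [d2 d20 H2] := powR_small (ltr0Sn R (2 * m.+2).-1) (divr_gt0 e0 C0).
  exists (Num.min d1 d2) => [|r]; first by rewrite lt_min d10.
  rewrite le_min => /and3P[r0 r1 r2]; split.
    apply: (@le_trans _ _ ((c + 1) * r `^ gamma)).
      by rewrite ler_wpM2r ?powR_ge0// lerDl.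
    by rewrite mulrC -ler_pdivlMr// H1// r0.
  by rewrite mulrC -ler_pdivlMr// -powR_mulrn// H2// r0.
have d2 : 0 < d / 2 by rewrite divr_gt0.
have [Z ZS Znet] := finite_net bO d2.
pose w z (q : 'rV[R]_n * R) :=
  psi (z, 0) + eta k + C * dot (q.1 - z) (q.1 - z) ^+ m.+2 + M * q.2.
have dotE x z : dot (x - z) (x - z) ^+ m.+2 = enorm (x - z) ^+ (2 * m.+2).
  by rewrite exprM enorm_sqr.
exists [seq w z | z <- Z]; split.
  move=> _ /mapP[z zZ ->]; have Oz := ZS _ zZ.
  have pz : pbd (z, 0) by right.
  split.
  - move=> -[x t] _.
    have cd : {for (x, t), continuous (fun q : 'rV[R]_n * R => dot (q.1 - z) (q.1 - z))}.
      apply: (@continuous_comp _ _ _ (@fst 'rV[R]_n R)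
        (fun y : 'rV[R]_n => dot (y - z) (y - z))); first exact: cvg_fst.
      exact: (@dot_continuous R n z).
    apply: (@cvgD _ _ _ (nbhs (x, t))).
      apply: (@cvgD _ _ _ (nbhs (x, t))); first exact: cvg_cst.
      apply: (@cvgM _ _ (nbhs (x, t))); first exact: cvg_cst.
      exact: (@continuous_comp _ _ _ _ (fun r : R => r ^+ m.+2) (x, t) cd
        (@exprn_continuous R m.+2 _)).
    apply: (@cvgM _ _ (nbhs (x, t))); first exact: cvg_cst.
    exact: (@cvg_snd _ _ (nbhs x) (nbhs t)).
  - move=> -[x t] cxt; have [/= Ox tT] := cxt.
    apply: HB => //; [by rewrite le_max lexx|exact: h_bnd|exact: diam].
  - move=> [x t] r [/= Ox /andP[t0 tT]] rt _ y s ys.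
    have s0 : 0 <= s by case: ys => /= [[_ /andP[/ltW]]|[_ ->]].
    have p1 := psi_lower pz ys.
    have e1 := HC (enorm (x - z)) (enorm_ge0 _).
    have k3 : c * enorm (z - y) `^ gamma <=
        c * enorm (x - z) `^ gamma + c * enorm (x - y) `^ gamma.
      by rewrite -mulrDr ler_wpM2l// (enormB x z); exact: enorm_gamma_le.
    have t1 : (L + k%:R) * t <= M * t by rewrite ler_wpM2r// ltW.
    have k1 : k%:R * r <= k%:R * t by rewrite ler_wpM2l.
    have L1 : L * `|0 - s| <= L * t + L * `|t - s|.
      rewrite -mulrDr ler_wpM2l// sub0r normrN ger0_norm//.
      by rewrite -lerBlDl distrC; exact: ler_norm.
    rewrite mulrDl in t1; rewrite /w /= dotE; exact: arith_lower p1 e1 k3 t1 k1 L1.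
move=> y Oy; have [z zZ yz] := Znet y Oy.
exists (w z); first by apply/mapP; exists z.
have n1 := @near_fst R _ (fun x => enorm (x - y) < d / 2) (y, 0) (near_enorm_lt y d2).
have n2 : \forall t \near (0 : R), M * t <= eta k.
  have M1 : 0 < M + 1 by rewrite ltr_wpDl.
  apply: filterS (nbhs0_lt (divr_gt0 e0 M1)) => t /ltW tM.
  apply: (@le_trans _ _ ((M + 1) * `|t|)); last by rewrite mulrC -ler_pdivlMr.
  apply: (@le_trans _ _ (M * `|t|)); first by rewrite ler_wpM2l// ler_norm.
  by rewrite ler_wpM2r// lerDl.
have n3 := @near_snd R 'rV[R]_n _ (y, 0) n2.
apply: filterS (filterI n1 n3) => -[x t] /= [xy Mt] _.
have xz : enorm (x - z) <= d.
  by apply: le_trans (enorm_dist y _ _) _; rewrite [leRHS]splitr lerD// ltW.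
have zy : enorm (z - y) <= d.
  by rewrite enormB (le_trans (ltW yz))// ler_pdivrMr// ler_pMr// ler1n.
have [_ b1] : c * enorm (x - z) `^ gamma <= eta k /\ C * enorm (x - z) ^+ (2 * m.+2) <= eta k.
  by apply: Hd; rewrite enorm_ge0.
have [b2 _] : c * enorm (z - y) `^ gamma <= eta k /\ C * enorm (z - y) ^+ (2 * m.+2) <= eta k.
  by apply: Hd; rewrite enorm_ge0.
have := psi_lh (or_intror (conj (ZS _ zZ) erefl)) (or_intror (conj Oy erefl)).
rewrite subrr normr0 mulr0 addr0 ler_norml => /andP[_ p1].
by rewrite /w /= dotE; exact: arith_upper p1 b1 b2 Mt.
Qed.

Lemma layer k : exists l : seq ('rV[R]_n * R -> R),
  (forall w, w \in l -> barrier_of_layer k w) /\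
  forall q, pbd q -> exists2 w, w \in l &
    \forall q' \near q, cyl q' -> w q' <= psi q + 4 * eta k.
Proof.
have e0 := eta_gt0 k.
have [M [Mr HM]] := bO.
have diam x y : Omega x -> Omega y -> enorm (x - y) <= n%:R * (2 * (M + 1)).
  move=> Ox Oy; apply: le_trans (enorm_le_mx_norm _) _; rewrite ler_wpM2l//.
  apply: le_trans (ler_normB _ _) _.
  have M1 : M < M + 1 by rewrite ltrDl.
  have := HM _ M1 x Ox; have := HM _ M1 y Oy => /=; lra.
have [m alpham] : exists m : nat, 0 <= (2 * m + 3)%:R * alpha + (2 * m + 2)%:R.
  have a1 : 0 < 1 + alpha by rewrite -ltrBlDl sub0r.
  (* The exponent equals [(2m+3)(1 + alpha) - 1], which is nonnegative once [m (1 + alpha) >= 1]. *)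
  pose m := (Num.Def.truncn (1 + alpha)^-1).+1; exists m.
  have mt : 1 <= m%:R * (1 + alpha).
    by rewrite -ler_pdivrMr// mul1r; apply: ltW; exact: truncnS_gt.
  rewrite natrD natrM natrD natrM; move: mt a1; move: (m%:R) => {}m; nra.
have [l1 [b1 u1]] := initial_layer k diam alpham.
have [Z ZS u2] := lateral_net k.
exists (l1 ++ [seq (fun q => psi (z, q.2) + (slope + k%:R) * Wb z q.1) | z <- Z]).
split.
  move=> w; rewrite mem_cat => /orP[/b1//|/mapP[z zZ ->]].
  by apply: lateral_barrier; exact: ZS.
move=> [y s] [[/= by_ sT]|[/= Oy ->]].
  have [z zZ H] := u2 y s by_ sT.
  exists (fun q => psi (z, q.2) + (slope + k%:R) * Wb z q.1).
    by rewrite mem_cat; apply/orP; right; apply/mapP; exists z.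
  apply: filterS H => q H cq; apply: le_trans (H cq) _.
  by rewrite lerD2l ler_wpM2r ?(ltW e0)// ler_nat.
have [w wl H] := u1 y Oy.
by exists w => //; rewrite mem_cat wl.
Qed.

(** A point of the cylinder has positive time and positive distance to the lateral boundary, and
    half of each survives nearby: a boundary point closer than [d / 2] would lie in a ball contained
    in [Omega]. *)
Lemma cylinder_growth q : cyl q -> exists2 m, 0 < m &
  \forall q' \near q, [/\ cyl q', m <= q'.2 &
    forall z, boundary Omega z -> m <= cb * enorm (q'.1 - z) `^ gamma].
Proof.
case: q => x t cq; have [/= Ox /andP[t0 tT]] := cq.
have /nbhs_ballP[d d0 dO] := open_nbhs_nbhs (conj oO Ox).
have d2 : 0 < d / 2 by rewrite divr_gt0.
exists (Num.min (t / 2) (cb * (d / 2) `^ gamma)).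
  by rewrite lt_min divr_gt0// mulr_gt0// powR_gt0.
have n1 := @near_fst R _ (fun y => ball x (d / 2) y) (x, t) (nbhsx_ballx x _ d2).
have tt : t / 2 < t by rewrite ltr_pdivrMr// ltr_pMr// ltr1n.
have n2 := @near_snd R 'rV[R]_n _ (x, t) (lt_nbhsr tt).
apply: filterS (filterI (near_cylinder cq) (filterI n1 n2)) => -[y s] [cy [/= xy ts]].
split=> //=; first by rewrite ge_min (ltW ts).
move=> z bz; rewrite ge_min; apply/orP; right.
rewrite ler_wpM2l ?(ltW cb_gt0)//.
apply: ge0_ler_powR; rewrite ?nnegrE ?enorm_ge0 ?(ltW d2) ?(ltW gamma_gt0)//.
rewrite leNgt; apply/negP => yz; apply: (boundary_notin bz); apply: dO.
move: xy; rewrite -ball_normE /= => xy.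
have -> : x - z = (x - y) + (y - z) by rewrite addrA subrK.
apply: le_lt_trans (ler_normD _ _) _; rewrite [ltRHS]splitr ltrD//.
exact: le_lt_trans (mx_norm_le_enorm _) yz.
Qed.

Lemma exists_contact_super : exists W : 'rV[R]_n * R -> R,
  [/\ {within cyl `|` pbd, continuous W},
      forall q, cyl q -> contact_super alpha F h G W q &
      forall q, pbd q -> W q = psi q].
Proof.
have arith (p u v z l l1 l2 r : R) : u <= v + z -> l <= l1 + l2 -> v + l1 <= 1 ->
    p - (z + l2) - 1 <= p - (u + l) by lra.
have [ls Hls] := choice layer.
have bar w : layered ls w -> exists k, barrier_of_layer k w.
  by move=> [k wk]; exists k; exact: (proj1 (Hls k)).
have lcont w : layered ls w -> forall q, cyl q -> {for q, continuous w}.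
  by move=> /bar[k [cw _ _]].
(* The case [m = 0] of the layer bound: every member, whatever its layer, respects the modulus of
   [psi] seen from [b]. *)
have lower q b w : cyl q -> pbd b -> layered ls w ->
    psi b - (c * enorm (q.1 - b.1) `^ gamma + L * `|q.2 - b.2|) <= w q.
  case: b => y s cq pb /bar[k [_ _ lw]].
  have q2 : 0 <= q.2 by have [_ /andP[/ltW]] := cq.
  have z0 z : boundary Omega z -> 0 <= cb * enorm (q.1 - z) `^ gamma.
    by move=> _; rewrite mulr_ge0 ?powR_ge0// ltW.
  by have := lw q 0 cq q2 z0 y s pb; rewrite mulr0 addr0.
have [x0 Ox0] := O0.
have p0 : pbd (x0, 0) by right.
have lne : layered ls !=set0.
  by have [w wl _] := proj2 (Hls 0%N) _ p0; exists w; exists 0%N.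
have llb q : cyl q -> has_lbound [set w q | w in layered ls].
  move=> cq; exists (psi (x0, 0) - (c * enorm (q.1 - x0) `^ gamma + L * `|q.2 - 0|)).
  by move=> _ [w fw <-]; exact: lower.
have loc q : cyl q -> (exists2 w, layered ls w & layered_inf ls q = w q) /\
    {for q, continuous (layered_inf ls)}.
  move=> cq; apply: (layered_inf_locally_finite lcont llb cq (near_cylinder cq) lne).
  have [m m0 nm] := cylinder_growth cq.
  exists m, (psi (x0, 0) - (c * enorm (q.1 - x0) `^ gamma + L * `|q.2 - 0|) - 1).
  split=> //; have n1 := near_modulus q (ltr01 : 0 < 1 :> R).
  apply: filterS (filterI nm n1) => q' [[cq' m1 m2] mod1] k w wk.
  have [_ _ lw] := proj1 (Hls k) w wk.
  apply: le_trans (lw q' m cq' m1 m2 x0 0 p0); rewrite lerD2r.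
  have e1 : c * enorm (q'.1 - x0) `^ gamma <=
      c * enorm (q'.1 - q.1) `^ gamma + c * enorm (q.1 - x0) `^ gamma.
    by rewrite -mulrDr ler_wpM2l//; exact: enorm_gamma_le.
  have e2 : L * `|q'.2 - 0| <= L * `|q'.2 - q.2| + L * `|q.2 - 0|.
    by rewrite -mulrDr ler_wpM2l// -[X in `|X|](subrKA q.2); exact: ler_normD.
  exact: arith e1 e2 mod1.
(* The two pieces do not overlap: the cylinder is disjoint from its parabolic boundary because
   [Omega] is open. *)
pose W q := if `[< cyl q >] then layered_inf ls q else psi q.
have Wcyl q : cyl q -> W q = layered_inf ls q by move=> cq; rewrite /W asboolT.
have Wpbd q : pbd q -> W q = psi q.
  by move=> pq; rewrite /W asboolF//; exact: pboundary_not_cylinder.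
have nW q : cyl q -> \forall q' \near q, layered_inf ls q' = W q'.
  by move=> cq; apply: filterS (near_cylinder cq) => q' cq'; rewrite Wcyl.
exists W; split=> //.
- apply/subspace_continuousP => q [cq|pq].
    apply: cvg_within_filter.
    exact: continuous_near_eq (nW q cq) (proj2 (loc q cq)).
  rewrite /from_subspace (Wpbd q pq); apply/cvgrPdist_le => e e0; rewrite near_withinE.
  (* At a boundary point one member of a sufficiently fine layer bounds [W] from above, while
     [lower] bounds all members from below. *)
  have [k k4] : exists k, 4 * eta k <= e.
    exists (Num.Def.truncn (4 / e)).
    by rewrite /eta ler_pdivrMr// mulrC -ler_pdivrMr//; apply: ltW; exact: truncnS_gt.
  have [w wl nw] := proj2 (Hls k) q pq.
  have n1 := near_modulus q e0.
  apply: filterS (filterI nw n1) => q' [wq' mod_] Sq'.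
  case: Sq' => [cq'|pq'].
    have fw : layered ls w by exists k.
    have le1 : W q' <= psi q + e.
      rewrite Wcyl//; apply: le_trans (layered_inf_le llb cq' fw) _.
      by apply: le_trans (wq' cq') _; rewrite lerD2l.
    have le2 : psi q - e <= W q'.
      rewrite Wcyl//; apply: le_layered_inf => // w' fw'.
      by apply: le_trans (lower q' q w' cq' pq fw'); rewrite lerD2l lerN2.
    by rewrite ler_distlC le2.
  rewrite Wpbd//; apply: le_trans mod_.
  case: q pq q' pq' {n1 nw wq'} => x t pq [y s] pq' /=.
  by rewrite distrC; exact: psi_lh.
- move=> q cq; have [[w fw Ew] _] := loc q cq.
  have [k [_ con _]] := bar w fw.
  apply: contact_super_le (con q cq); first by rewrite Wcyl.
  by apply: filterS (near_cylinder cq) => q' cq'; rewrite Wcyl//; exact: (layered_inf_le llb).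
Qed.

End Construction.

(** Phrased through contact from below and a generic homogeneous elliptic operator, so that it
    serves both [F] and the dual operator [- F x (- p) (- X)]. *)
Lemma contact_super_of_barrier (R : realType) (n : nat) (Omega : set 'rV[R]_n)
    (T alpha a A gamma G : R) (F : 'rV[R]_n -> 'rV[R]_n -> 'M[R]_n -> R)
    (h : 'rV[R]_n * R -> 'rV[R]_n) (psi : 'rV[R]_n * R -> R) :
  -1 < alpha -> 0 < a <= A -> bounded_domain Omega ->
  (forall (t mu : R) x p X, t != 0 -> 0 <= mu -> Omega x -> p != 0 -> symmx X ->
    F x (t *: p) (mu *: X) = `|t| `^ alpha * mu * F x p X) ->
  F_elliptic Omega alpha a A F -> h_assumption Omega T alpha h -> 0 < gamma < 1 ->
  (exists c C : R, 0 < c <= C /\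
    forall z, boundary Omega z -> exists Wz : 'rV[R]_n -> R,
    [/\ {within closure Omega, continuous Wz},
        forall x, Omega x ->
          c * enorm (x - z) `^ gamma <= Wz x <= C * enorm (x - z) `^ gamma,
        forall x phi, Omega x -> C2_near x phi -> touches_below phi Wz x ->
          grad phi x != 0 &
        forall t x phi, 0 < t < T -> Omega x -> C2_near x phi ->
          touches_below phi Wz x ->
          spatial_op F h alpha (x, t) (grad phi x) (hess phi x) <= - 1]) ->
  lip_holder Omega T gamma psi ->
  exists W : 'rV[R]_n * R -> R,
    [/\ {within cylinder Omega T `|` pboundary Omega T, continuous W},
        forall q, cylinder Omega T q -> contact_super alpha F h G W q &
        forall q, pboundary Omega T q -> W q = psi q].
Proof.
move=> alpha1 /andP[a0 aA] [oO _ O0 bO] Fhom Fell [_ [Mh hM] _] /andP[g0 g1].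
move=> [cb [Cb [/andP[cb0 cCb] bar]]] [c [L psiL]].
pose is_barrier z (Wz : 'rV[R]_n -> R) :=
  [/\ {within closure Omega, continuous Wz},
      forall x, Omega x ->
        cb * enorm (x - z) `^ gamma <= Wz x <= Cb * enorm (x - z) `^ gamma,
      forall x phi, Omega x -> C2_near x phi -> touches_below phi Wz x ->
        grad phi x != 0 &
      forall t x phi, 0 < t < T -> Omega x -> C2_near x phi ->
        touches_below phi Wz x ->
        spatial_op F h alpha (x, t) (grad phi x) (hess phi x) <= - 1].
(* One barrier is chosen for each boundary point; elsewhere the zero function is a dummy value. *)
have ex z : exists Wz, boundary Omega z -> is_barrier z Wz.
  have [bz|nbz] := pselect (boundary Omega z); last by exists (fun=> 0).
  by have [Wz HWz] := bar z bz; exists Wz.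
have [Wb HWb] := choice ex.
have g01 : 0 < gamma <= 1 by rewrite g0 ltW.
have A0 : 0 <= A by rewrite (le_trans _ aA)// ltW.
(* The constants of [lip_holder] carry no sign, hence the absolute values. *)
have psiL' x t y s : pboundary Omega T (x, t) -> pboundary Omega T (y, s) ->
    `|psi (x, t) - psi (y, s)| <= `|c| * enorm (x - y) `^ gamma + `|L| * `|t - s|.
  move=> px py; apply: le_trans (psiL _ _ _ _ px py) _.
  by apply: lerD; apply: ler_wpM2r; rewrite ?powR_ge0 ?ler_norm.
apply: (@exists_contact_super R n Omega T alpha a A gamma G `|c| `|L| Mh cb Cb F h psi Wb
  (ltW a0) A0 alpha1 g01 (normr_ge0 _) (normr_ge0 _) cb0 cCb oO O0 bO Fhom Fell hM psiL').
- by move=> z bz; have [] := HWb z bz.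
- by move=> z x bz; have [_ H _ _] := HWb z bz; exact: H.
- by move=> z x phi bz; have [_ _ H _] := HWb z bz; exact: H.
- by move=> z x t phi bz; have [_ _ _ H] := HWb z bz; exact: H.
Qed.

(** * The supersolution and, by duality, the subsolution *)

Theorem proposition2 (R : realType) (n : nat) (Omega : set 'rV[R]_n)
    (T alpha a A gamma : R)
    (F : 'rV[R]_n -> 'rV[R]_n -> 'M[R]_n -> R)
    (h : 'rV[R]_n * R -> 'rV[R]_n)
    (psi f : 'rV[R]_n * R -> R)
    (n_gt0 : (0 < n)%N)
    (T_gt0 : 0 < T) (alpha_gt : -1 < alpha) (aA : 0 < a <= A)
    (dom : bounded_domain Omega)
    (cone : uniform_exterior_cone Omega)
    (F1 : F_homogeneous Omega alpha F)
    (F2 : F_elliptic Omega alpha a A F)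
    (F3 : F_modulus Omega F)
    (hh : h_assumption Omega T alpha h)
    (hgamma : barrier_exponent Omega T alpha F h gamma)
    (hpsi : lip_holder Omega T gamma psi)
    (hf : bounded_on_cylinder Omega T f) :
  (exists W : 'rV[R]_n * R -> R,
     [/\ {within cylinder Omega T `|` pboundary Omega T, continuous W},
         supersolution Omega T alpha F h (fun=> sup_norm Omega T f) W &
         forall q, pboundary Omega T q -> W q = psi q]) /\
  (exists V : 'rV[R]_n * R -> R,
     [/\ {within cylinder Omega T `|` pboundary Omega T, continuous V},
         subsolution Omega T alpha F h (fun=> - sup_norm Omega T f) V &
         forall q, pboundary Omega T q -> V q = psi q]).
Proof.
have [_ Fhom] := F1; have [g01 [c [C [cC bar]]]] := hgamma.
split.
  have [|W [cW con Wpsi]] := contact_super_of_barrier (sup_norm Omega T f) alpha_gt aA dom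
    Fhom F2 hh g01 _ hpsi.
    exists c, C; split=> // z bz; have [Wz [W1 _ W3 W4 W5]] := bar z bz.
    exists Wz; split=> // t x phi tT; exact: (proj1 (W5 t tT)).
  exists W; split=> //; apply: contact_supersolution con.
  by apply: continuous_subspaceW cW; exact: subsetUl.
(* The equation for [- V] has the operator [- F x (- p) (- X)]. *)
pose F' x p (X : 'M[R]_n) := - F x (- p) (- X).
have symN (X : 'M[R]_n) : symmx X -> symmx (- X).
  by move=> sX; rewrite /symmx linearN /= sX.
have F'hom (t mu : R) x p X : t != 0 -> 0 <= mu -> Omega x -> p != 0 -> symmx X ->
    F' x (t *: p) (mu *: X) = `|t| `^ alpha * mu * F' x p X.
  move=> t0 mu0 Ox p0 sX; rewrite /F' -!scalerN Fhom ?oppr_eq0// ?mulrN//.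
  exact: symN.
have F'ell : F_elliptic Omega alpha a A F'.
  (* Ellipticity of [F] is used at [- p] with base matrix [- (X + Y)] and increment [Y], which leads
     to [- X]. *)
  move=> x p X Y Ox p0 sX sY Y0; rewrite -(enormN p).
  have p0' : - p != 0 by rewrite oppr_eq0.
  have sXY : symmx (- (X + Y)) by apply: symN; rewrite /symmx linearD /= sX sY.
  have XY : - (X + Y) + Y = - X by rewrite opprD addrNK.
  have := F2 x _ _ _ Ox p0' sXY sY Y0; rewrite XY /F' opprK.
  by rewrite [- F x _ _ + _]addrC.
have hpsi' : lip_holder Omega T gamma (fun q => - psi q).
  have [cp [L H]] := hpsi; exists cp, L => x t y s px py.
  by rewrite -opprD normrN; exact: H.
have [|W [cW con Wpsi]] := contact_super_of_barrier (sup_norm Omega T f) alpha_gt aA dom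
    F'hom F'ell hh g01 _ hpsi'.
  exists c, C; split=> // z bz; have [Wz [W1 _ W3 W4 W5]] := bar z bz.
  exists Wz; split=> // t x phi tT Ox Cphi [E tb].
  (* The negative of a test function below [Wz] lies above [- Wz]; there the second half of the
     barrier property gives at least [1], which is at most [-1] for the dual operator. *)
  have := proj2 (W5 t tT) x (fun y => -1 * phi y + 0) Ox (C2_near_affine _ _ Cphi).
  rewrite grad_affine// hess_affine// !scaleN1r /spatial_op /F' /= enormN dotNr => H.
  suff /H : touches_above (fun y => -1 * phi y + 0) (fun y => - Wz y) x.
    by rewrite mulNr; move: (F _ _ _) (_ * _) => u v; lra.
  split; first by rewrite E mulN1r addr0.
  by apply: filterS tb => y; rewrite mulN1r addr0 lerN2.
exists (fun q => - W q); split.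
- by move=> q; apply: cvgN; exact: cW.
- apply: contact_subsolution con.
  by apply: continuous_subspaceW cW; exact: subsetUl.
- by move=> q /Wpsi ->; rewrite opprK.
Qed.
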